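(* Let $1 \le p < \infty$, $p \neq 2$, and let $(e^{tA})_{t \ge 0}$ be a strongly continuous semigroup with generator $A$ on $l^p = l^p(\mathbb{N}; \mathbb{R})$. If $(e^{tA})_{t\ge 0}$ is weakly asymptotically contractive, then $\sigma_{\mathrm{pnt}}(A) \cap i \mathbb{R} \subset \{0\}$. If, in addition, $A$ has compact resolvent, then $e^{tA}$ converges strongly as $t \to \infty$.
   Context: A $C_0$-semigroup $(e^{tA})_{t\ge 0}$ on a real Banach space $X$ is called weakly asymptotically contractive if $\limsup_{t \to \infty} |\langle e^{tA}x, x' \rangle| \le 1$ for all $x \in X$ and all $x' \in X'$ (the norm dual) with $\|x\| = \|x'\| = 1$. Complexification: for a real Banach space $X$, a complexification of $X$ is a complex Banach space $X_{\mathbb{C}}$ containing $X$ isometrically as a real subspace such that $X_{\mathbb{C}} = X \oplus iX$ and such that the $\mathbb{R}$-linear projection of $X_{\mathbb{C}}$ onto $X$ along $iX$ is contractive. Every real Banach space has a complexification. A linear operator $A: X \supset D(A) \to X$ has a unique $\mathbb{C}$-linear extension $A_{\mathbb{C}}$ with domain $D(A)+iD(A)$. The point spectrum $\sigma_{\mathrm{pnt}}(A)$ (set of eigenvalues) is defined to be $\sigma_{\mathrm{pnt}}(A_{\mathbb{C}})$, and $A$ is said to have compact resolvent if $A_{\mathbb{C}}$ has compact resolvent; neither depends on the choice of complexification. *)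

(* Defs.v *)
From HB Require Import structures.
From mathcomp Require Import all_boot all_order all_algebra.
From mathcomp Require Import complex ring.
From mathcomp Require Import all_classical all_reals all_analysis.
Set Implicit Arguments.
Unset Strict Implicit.
Unset Printing Implicit Defensive.
Import Order.TTheory GRing.Theory Num.Theory.
Import numFieldNormedType.Exports.
Local Open Scope classical_set_scope.
Local Open Scope ring_scope.

(* For the counting measure on [nat] every function is measurable and
   almost-everywhere equality is equality, so that no quotient is needed. *)
Definition lp (R : realType) (p : R) (p1 : 1 <= p) : Type :=
  @LfunType _ nat R (@counting nat R) p%:E p1.

Section lp_banach.
Context (R : realType) (p : R) (p1 : 1 <= p).
Local Notation E := (lp p1).
Local Notation Lf := (@LfunType _ nat R (@counting nat R) p%:E p1).

HB.instance Definition _ := GRing.Lmodule.copy E Lf.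

Definition lp_seq (x : E) : nat -> R := (x : Lf).

Definition lp_norm (x : E) : R := fine 'N[counting]_p%:E[EFin \o lp_seq x].

Let p0 : 0 < p. Proof. exact: lt_le_trans p1. Qed.

Let ler_lp_normD (x y : E) : lp_norm (x + y) <= lp_norm x + lp_norm y.
Proof. exact: (@ler_LnormD _ _ _ counting p%:E p1). Qed.

Let lp_normZ (a : R) (x : E) : lp_norm (a *: x) = `|a| * lp_norm x.
Proof.
apply/EFin_inj; rewrite EFinM /lp_norm.
rewrite (@finite_norm_fine _ _ _ counting p%:E p1 (a *: (x : Lf))).
rewrite (@finite_norm_fine _ _ _ counting p%:E p1 (x : Lf)).
exact: (@LnormZ _ _ _ counting p%:E p1).
Qed.

Let lp_norm_ge0 (x : E) : 0 <= lp_norm x.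
Proof. exact/fine_ge0/Lnorm_ge0. Qed.

Lemma lp_normE (x : E) :
  (lp_norm x `^ p)%:E = (\sum_(0 <= k <oo) (`|lp_seq x k| `^ p)%:E)%E.
Proof.
rewrite -poweR_EFin /lp_norm.
rewrite (@finite_norm_fine _ _ _ counting p%:E p1 (x : Lf)).
rewrite Lnorm_counting// -poweRrM mulVf ?gt_eqF// poweRe1//.
by apply: nneseries_ge0 => k _ _; exact: poweR_ge0.
Qed.

Lemma lp_sum_le (x : E) n :
  \sum_(0 <= k < n) `|lp_seq x k| `^ p <= lp_norm x `^ p.
Proof.
rewrite -lee_fin lp_normE -sumEFin; apply: nneseries_lim_ge => k _ _.
by rewrite lee_fin powR_ge0.
Qed.

Lemma lp_coord_le (x : E) k : `|lp_seq x k| <= lp_norm x.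
Proof.
have : `|lp_seq x k| `^ p <= lp_norm x `^ p.
  apply: le_trans (lp_sum_le x k.+1).
  by rewrite big_nat_recr//= lerDr sumr_ge0// => i _; exact: powR_ge0.
by apply: contraTT; rewrite -!ltNge; apply: gt0_ltr_powR; rewrite ?nnegrE.
Qed.

Let lp_norm0_eq0 (x : E) : lp_norm x = 0 -> x = 0.
Proof.
move=> x0; apply/(@LfuneqP _ _ _ counting p%:E p1) => k.
by apply/eqP; rewrite -normr_le0 -x0; exact: lp_coord_le.
Qed.

HB.instance Definition _ :=
  Lmodule_isNormed.Build R E ler_lp_normD lp_normZ lp_norm0_eq0.

Lemma lp_bounded_sum (u : nat -> R) (C : R) : 0 <= C ->
  (forall n, \sum_(0 <= k < n) `|u k| `^ p <= C `^ p) ->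
  exists2 x : E, lp_seq x = u & `|x| <= C.
Proof.
move=> C0 uC.
have sC : (\sum_(0 <= k <oo) (`|u k| `^ p)%:E <= (C `^ p)%:E)%E.
  apply: lime_le; first by apply: is_cvg_nneseries => k _ _; rewrite lee_fin powR_ge0.
  by apply: nearW => n; rewrite sumEFin lee_fin.
have s0 : (0 <= \sum_(0 <= k <oo) (`|u k| `^ p)%:E)%E.
  by apply: nneseries_ge0 => k _ _; rewrite lee_fin powR_ge0.
have fu : u \in Lfun (@counting nat R) p%:E.
  rewrite inE; apply/andP; split; rewrite inE//=.
  by rewrite /finite_norm Lnorm_counting//= poweR_lty// (le_lt_trans sC)// ltry.
exists (@Lfun_Sub _ nat R counting p%:E p1 u fu : E) => //.
have := lp_normE (@Lfun_Sub _ nat R counting p%:E p1 u fu : E).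
move: sC => /[swap] <-; rewrite lee_fin.
by apply: contraTT; rewrite -!ltNge; apply: gt0_ltr_powR; rewrite ?nnegrE ?lp_norm_ge0.
Qed.

Let normr_powR_continuous : continuous (fun a : R => `|a| `^ p).
Proof.
move=> a; have [->|a0] := eqVneq a 0; last first.
  apply: (@cvg_comp _ _ _ Num.norm (fun b : R => b `^ p) _ (nbhs `|a|)).
    exact: norm_continuous.
  suff : {for `|a|, continuous (fun b : R => b `^ p)} by [].
  apply: differentiable_continuous; apply/derivable1_diffP.
  by apply: derivable_powR; rewrite in_itv/= andbT normr_gt0.
apply/cvgrPdist_lt => e e0 /=; rewrite normr0 powR0 ?gt_eqF//.
near=> b; rewrite sub0r normrN ger0_norm ?powR_ge0//.
rewrite -[ltRHS](@powRr1 _ e) ?ltW// -(@mulVf _ p) ?gt_eqF// powRrM.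
apply: gt0_ltr_powR; rewrite ?nnegrE ?powR_ge0//.
near: b; apply: (@cvgr0_norm_lt _ _ _ (nbhs (0:R))); [exact: cvg_id|].
exact: powR_gt0.
Unshelve. all: by end_near. Qed.

Let lp_seqB (x y : E) k : lp_seq (x - y) k = lp_seq x k - lp_seq y k.
Proof. by []. Qed.

Let lp_complete (F : set_system E) : ProperFilter F -> cauchy F -> cvg F.
Proof.
move=> FF /cauchyP cF.
have cvk k : cvg ((lp_seq x k) @[x --> F]).
  apply: R_complete; apply: cauchy_exP => e e0; have [x xe] := cF _ e0.
  exists (lp_seq x k).
  suff : \forall y \near F, ball (lp_seq x k) e (lp_seq y k) by [].
  apply: filterS xe => y; rewrite -!ball_normE/= => /(le_lt_trans _); apply.
  by rewrite -lp_seqB; exact: lp_coord_le.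
pose u k := lim (lp_seq x k @[x --> F]).
have tail e : 0 < e -> exists x : E, (\forall y \near F, `|x - y| < e) /\
    exists2 z : E, lp_seq z = (fun k => lp_seq x k - u k) & `|z| <= e.
  move=> e0; have [x xe] := cF _ e0.
  have {}xe : \forall y \near F, `|x - y| < e.
    by apply: filterS xe => y; rewrite -ball_normE.
  exists x; split => //; apply: lp_bounded_sum; first exact: ltW.
  move=> n.
  have : (\sum_(0 <= k < n) `|lp_seq x k - lp_seq y k| `^ p) @[y --> F] -->
         \sum_(0 <= k < n) `|lp_seq x k - u k| `^ p.
    apply: cvg_big => [|k _]; first exact: add_continuous.
    have : lp_seq x k - lp_seq y k @[y --> F] --> lp_seq x k - u k.
      by apply: cvgB; [exact: cvg_cst|exact: cvk].
    move=> h; apply: (@cvg_comp _ _ _ _ (fun a : R => `|a| `^ p) _ _ _ h).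
    exact: normr_powR_continuous.
  move=> /cvgr_to_le; apply; apply: filterS xe => y xy.
  under eq_bigr do rewrite -lp_seqB.
  apply: le_trans (lp_sum_le _ _) _.
  by apply: ge0_ler_powR; rewrite ?nnegrE ?lp_norm_ge0// ltW.
have [x1 [_ [z1 z1E _]]] := tail _ ltr01.
have xu : lp_seq (x1 - z1) = u.
  by apply/funext => k; rewrite lp_seqB z1E subKr.
apply/cvg_ex; exists (x1 - z1); apply/cvgrPdist_lt => e e0.
have [x [xe [z zE ze]]] := tail _ (divr_gt0 e0 (ltr0Sn R 1)).
have -> : x1 - z1 = x - z.
  apply/(@LfuneqP _ _ _ counting p%:E p1) => k.
  by rewrite -!/(lp_seq _ _) !lp_seqB z1E zE !subKr.
apply: filterS xe => y xy.
rewrite addrAC [ltRHS]splitr (le_lt_trans (ler_normB _ _))//.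
by rewrite ltr_leD.
Qed.

HB.instance Definition _ := Uniform_isComplete.Build E lp_complete.

End lp_banach.

Section semigroups.
Context (R : realType) (X : completeNormedModType R).

(* Only the values of [T] at nonnegative times are relevant. *)
Definition C0_semigroup (T : R -> {linear X -> X}) : Prop :=
  [/\ forall t, 0 <= t -> continuous (T t),
      forall x, T 0 x = x,
      forall s t x, 0 <= s -> 0 <= t -> T (s + t) x = T s (T t x) &
      forall x, T t x @[t --> 0^'+] --> x].

Definition dual_norm (f : {scalar X}) : R :=
  sup [set `|f x| | x in [set x : X | `|x| <= 1]].

Definition weakly_asymptotically_contractive (T : R -> {linear X -> X}) : Prop :=
  forall (x : X) (f : {scalar X}), `|x| = 1 ->
    continuous f -> dual_norm f = 1 ->
    (limf_esup (fun t => `|f (T t x)|%:E) (+oo_R) <= 1)%E.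

Definition converges_strongly (T : R -> {linear X -> X}) : Prop :=
  exists P : {linear X -> X},
    continuous P /\ forall x, T t x @[t --> +oo_R] --> P x.

End semigroups.

(* An unbounded operator; [app] is meaningful on [dom] only. *)
Record operator (V : Type) := Operator { dom : set V ; app :> V -> V }.

Definition generator (R : realType) (X : completeNormedModType R)
    (T : R -> {linear X -> X}) : operator X :=
  let quotient x := t^-1 *: (T t x - x) @[t --> 0^'+] in
  Operator [set x | cvg (quotient x)] (fun x => lim (quotient x)).

Section spectral.
Context (K : numFieldType) (V : completeNormedModType K).

Definition eigenvalues (A : operator V) : set K :=
  [set l | exists z, [/\ dom A z, z != 0 & A z = l *: z]].

Definition is_resolvent (A : operator V) (l : K) (S : {linear V -> V}) : Prop :=
  [/\ continuous S,
      forall z, dom A (S z) /\ l *: S z - A (S z) = z &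
      forall z, dom A z -> S (l *: z - A z) = z].

Definition compact_operator (S : V -> V) : Prop :=
  compact (closure (S @` [set z | `|z| <= 1])).

Definition some_resolvent_compact (A : operator V) : Prop :=
  exists (l : K) (S : {linear V -> V}), is_resolvent A l S /\ compact_operator S.

End spectral.

Section complexification.
Local Open Scope complex_scope.

Record complexification (R : realType) (X : completeNormedModType R) :=
  Complexification {
    cplx_space :> completeNormedModType R[i] ;
    cplx_in : X -> cplx_space ;
    cplx_re : cplx_space -> X ;
    cplx_im : cplx_space -> X ;
    cplx_in_linear : forall (a : R) (x y : X),
      cplx_in (a *: x + y) = a%:C *: cplx_in x + cplx_in y ;
    cplx_in_norm : forall x : X, `|cplx_in x| = `|x|%:C ;
    cplx_decomp : forall z, z = cplx_in (cplx_re z) + 'i *: cplx_in (cplx_im z) ;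
    cplx_reK : forall x y : X, cplx_re (cplx_in x + 'i *: cplx_in y) = x ;
    cplx_imK : forall x y : X, cplx_im (cplx_in x + 'i *: cplx_in y) = y ;
    cplx_re_contractive : forall z, `|cplx_re z|%:C <= `|z|
  }.

Definition complexify (R : realType) (X : completeNormedModType R)
    (XC : complexification X) (A : operator X) : operator XC :=
  Operator
    [set cplx_in XC x + 'i *: cplx_in XC y | x in dom A & y in dom A]
    (fun z => cplx_in XC (A (cplx_re z)) + 'i *: cplx_in XC (A (cplx_im z))).

Definition point_spectrum (R : realType) (X : completeNormedModType R)
    (XC : complexification X) (A : operator X) : set R[i] :=
  eigenvalues (complexify XC A).

Definition compact_resolvent (R : realType) (X : completeNormedModType R)
    (XC : complexification X) (A : operator X) : Prop :=
  some_resolvent_compact (complexify XC A).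

Definition imaginary_axis (R : realType) : set R[i] :=
  [set l | complex.Re l = 0].

End complexification.
Arguments imaginary_axis : clear implicits.

(* The Taylor complexification, normed by [sup_theta `|cos theta x + sin theta y|],
   witnesses that every real Banach space has a complexification. *)
Definition taylor (R : realType) (X : completeNormedModType R) : Type :=
  (X * X)%type.

Section taylor.
Local Open Scope complex_scope.
Context (R : realType) (X : completeNormedModType R).
Local Notation T := (taylor X).

HB.instance Definition _ := GRing.Zmodule.copy T (X * X)%type.

Definition taylor_scale (l : R[i]) (z : T) : T :=
  (complex.Re l *: z.1 - complex.Im l *: z.2,
   complex.Re l *: z.2 + complex.Im l *: z.1).

Let scaleA (a b : R[i]) (z : T) :
  taylor_scale a (taylor_scale b z) = taylor_scale (a * b) z.
Proof.
case: a b z => [a1 a2] [b1 b2] [x y]; congr pair => /=.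
  rewrite !scalerBr !scalerBl !scalerDr !scalerDl !scalerA !opprD.
  by rewrite [Z in _ + Z = _]addrC addrACA.
rewrite !scalerBr !scalerDr !scalerBl !scalerDl !scalerA.
by rewrite [Z in _ + Z = _]addrC addrACA.
Qed.

Let scale1 : left_id 1 taylor_scale.
Proof.
case=> x y; congr pair => /=.
  by rewrite scale1r scale0r subr0.
by rewrite scale1r scale0r addr0.
Qed.

Let scaleDr : right_distributive taylor_scale +%R.
Proof.
move=> [a1 a2] [x y] [x' y']; congr pair => /=.
  by rewrite !scalerDr opprD addrACA.
by rewrite !scalerDr addrACA.
Qed.

Let scaleDl (z : T) : {morph taylor_scale^~ z : a b / a + b}.
Proof.
case: z => x y [a1 a2] [b1 b2]; congr pair => /=.
  by rewrite !scalerDl opprD addrACA.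
by rewrite !scalerDl addrACA.
Qed.

HB.instance Definition _ := GRing.Zmodule_isLmodule.Build R[i] T
  scaleA scale1 scaleDr scaleDl.

Definition taylor_circle (z : T) : set R :=
  [set `|ab.1 *: z.1 + ab.2 *: z.2|
  | ab in [set ab : R * R | ab.1 ^+ 2 + ab.2 ^+ 2 = 1]].

Definition taylor_sup (z : T) : R := sup (taylor_circle z).

Let sqr_le1 (a b : R) : a ^+ 2 + b ^+ 2 = 1 -> `|a| <= 1.
Proof.
move=> ab; rewrite -(@expr_le1 _ 2)// real_normK ?num_real// -ab.
by rewrite lerDl sqr_ge0.
Qed.

Let circle_sup z : has_sup (taylor_circle z).
Proof.
split; first by exists `|1 *: z.1 + 0 *: z.2|, (1, 0) => //=; rewrite expr1n expr0n addr0.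
exists (`|z.1| + `|z.2|) => _ [[a b]/= ab <-].
rewrite (le_trans (ler_normD _ _))// !normrZ lerD//.
  by rewrite ler_piMl// (sqr_le1 ab).
by rewrite ler_piMl// (@sqr_le1 b a)// addrC.
Qed.

Let nrm_ge z a b : a ^+ 2 + b ^+ 2 = 1 -> `|a *: z.1 + b *: z.2| <= taylor_sup z.
Proof. by move=> ab; apply: sup_upper_bound => //; exists (a, b). Qed.

Let nrm_le z M : (forall a b, a ^+ 2 + b ^+ 2 = 1 -> `|a *: z.1 + b *: z.2| <= M) ->
  taylor_sup z <= M.
Proof.
move=> h; apply: ge_sup; first by case: (circle_sup z).
by move=> _ [[a b]/= ab <-]; exact: h.
Qed.

Let nrm_re z : `|z.1| <= taylor_sup z.
Proof.
have := @nrm_ge z 1 0; rewrite scale1r scale0r addr0; apply.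
by rewrite expr1n expr0n addr0.
Qed.

Let nrm_im z : `|z.2| <= taylor_sup z.
Proof.
have := @nrm_ge z 0 1; rewrite scale1r scale0r add0r; apply.
by rewrite expr1n expr0n add0r.
Qed.

Let nrm_ub z : taylor_sup z <= `|z.1| + `|z.2|.
Proof.
apply: nrm_le => a b ab.
rewrite (le_trans (ler_normD _ _))// !normrZ lerD//.
  by rewrite ler_piMl// (sqr_le1 ab).
by rewrite ler_piMl// (@sqr_le1 b a)// addrC.
Qed.

Let nrm_ge0 z : 0 <= taylor_sup z. Proof. exact: le_trans (nrm_re z). Qed.

Let nrmD z w : taylor_sup (z + w) <= taylor_sup z + taylor_sup w.
Proof.
apply: nrm_le => a b ab /=.
rewrite !scalerDr addrACA (le_trans (ler_normD _ _))// lerD//; exact: nrm_ge.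
Qed.

Let nrmZ_le (l : R[i]) z : (taylor_sup (l *: z))%:C <= `|l| * (taylor_sup z)%:C.
Proof.
have [->|l0] := eqVneq l 0.
  rewrite scale0r normr0 mul0r lecR; apply: nrm_le => a b _ /=.
  by rewrite !scaler0 addr0 normr0.
case: l l0 => c d l0; rewrite normc_def -rmorphM/= lecR.
set r := Num.sqrt _; have r2 : r ^+ 2 = c ^+ 2 + d ^+ 2.
  by rewrite sqr_sqrtr// addr_ge0 ?sqr_ge0.
have r0 : 0 < r.
  rewrite lt0r sqrtr_ge0 andbT; apply: contra l0 => /eqP r0.
  move: r2; rewrite r0 expr0n/= => /esym/eqP.
  by rewrite paddr_eq0 ?sqr_ge0// !sqrf_eq0 => /andP[/eqP-> /eqP->].
apply: nrm_le => a b ab /=.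
have -> : a *: (c *: z.1 - d *: z.2) + b *: (c *: z.2 + d *: z.1) =
    r *: (((a * c + b * d) / r) *: z.1 + ((b * c - a * d) / r) *: z.2).
  rewrite !scalerDr !scalerN !scalerA ![r * _]mulrC !divfK ?gt_eqF//.
  rewrite scalerBl scalerDl [Z in _ + Z = _]addrC addrACA.
  by rewrite [Z in _ = _ + Z]addrC.
rewrite normrZ gtr0_norm// ler_wpM2l ?(ltW r0)//.

 apply: nrm_ge.
rewrite !expr_div_n -mulrDl r2.
have -> : (a * c + b * d) ^+ 2 + (b * c - a * d) ^+ 2 =
   (a ^+ 2 + b ^+ 2) * (c ^+ 2 + d ^+ 2) by ring.
by rewrite ab mul1r divff// -r2 expf_neq0// gt_eqF.
Qed.

Definition taylor_norm (z : T) : R[i] := (taylor_sup z)%:C.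

Let normD z w : taylor_norm (z + w) <= taylor_norm z + taylor_norm w.
Proof. by rewrite -rmorphD/= lecR. Qed.

Let normZ l z : taylor_norm (l *: z) = `|l| * taylor_norm z.
Proof.
apply/eqP; rewrite eq_le nrmZ_le/=.
have [->|l0] := eqVneq l 0; first by rewrite normr0 mul0r lecR.
have := nrmZ_le l^-1 (l *: z); rewrite scalerA mulVf// scale1r normfV.
by rewrite ler_pdivlMl// normr_gt0.
Qed.

Let norm0_eq0 z : taylor_norm z = 0 -> z = 0.
Proof.
move=> /(congr1 (@complex.Re R))/= z0.
have := nrm_im z; have := nrm_re z; rewrite z0 !normr_le0.
by case: z {z0} => x y /= /eqP-> /eqP->.
Qed.

HB.instance Definition _ := Lmodule_isNormed.Build R[i] T normD normZ norm0_eq0.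

Let taylor_complete (F : set_system T) : ProperFilter F -> cauchy F -> cvg F.
Proof.
move=> FF /cauchyP cF.
have cF' (e : R) : 0 < e -> exists z : T, \forall w \near F, taylor_sup (z - w) < e.
  move=> e0; have [|z ze] := cF e%:C; first by rewrite ltcR.
  exists z; apply: filterS ze => w; rewrite -ball_normE/=.
  by rewrite /Num.norm/= ltcR.
have cv1 : cvg (z.1 @[z --> F]).
  apply: cauchy_cvg; apply: cauchy_exP => e e0; have [z ze] := cF' _ e0.
  exists z.1; suff : \forall w \near F, ball z.1 e w.1 by [].
  apply: filterS ze => w; rewrite -ball_normE/=; apply: le_lt_trans.
  exact: (nrm_re (z - w)).
have cv2 : cvg (z.2 @[z --> F]).
  apply: cauchy_cvg; apply: cauchy_exP => e e0; have [z ze] := cF' _ e0.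
  exists z.2; suff : \forall w \near F, ball z.2 e w.2 by [].
  apply: filterS ze => w; rewrite -ball_normE/=; apply: le_lt_trans.
  exact: (nrm_im (z - w)).
apply/cvg_ex; exists ((lim (z.1 @[z --> F]), lim (z.2 @[z --> F])) : T).
apply/cvgrPdist_lt => -[e ?]; rewrite ltcE/= => /andP[/eqP-> e0].
have e20 : 0 < e / 2 by rewrite divr_gt0.
move/cvgrPdist_lt : cv1 => /(_ _ e20) h1; move/cvgrPdist_lt : cv2 => /(_ _ e20) h2.
near=> w.
rewrite [Z in Z < _]/Num.norm/= [Z in _ < Z](_ : _ = e%:C)// ltcR.
apply: le_lt_trans (nrm_ub _) _; rewrite [ltRHS]splitr ltrD//=.
  by near: w; exact: h1.
by near: w; exact: h2.
Unshelve. all: by end_near. Qed.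

HB.instance Definition _ := Uniform_isComplete.Build T taylor_complete.

Definition taylor_complexification : complexification X.
Proof.
exists T (fun x => (x, 0) : T) (fun z => z.1) (fun z => z.2).
- move=> a x y; congr pair => /=.
    by rewrite scaler0 subr0.
  by rewrite scaler0 scale0r !addr0.
- move=> x; rewrite -[LHS]/(taylor_sup (x, 0))%:C; congr (_%:C).
  apply/eqP; rewrite eq_le (nrm_re (x, 0)) andbT.
  by rewrite (le_trans (nrm_ub _))//= normr0 addr0.
- move=> [x y]; congr pair => /=.
    by rewrite scale0r scaler0 oppr0 !addr0.
  by rewrite scale0r scale1r !add0r.
- by move=> x y /=; rewrite scale0r scaler0 oppr0 !addr0.
- by move=> x y /=; rewrite scale0r scale1r !add0r.
- by move=> z; rewrite -[leRHS]/(taylor_sup z)%:C lecR.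
Defined.

End taylor.

(* Main.v *)
(** The core is a rigidity property of [l^r] for [r < 2]: a continuous curve [g : R -> l^r]
    such that the norm of every linear combination of translates of [g] is invariant under
    translation is constant. Indeed, smoothing [g] twice, one may assume it twice
    differentiable. If the [k]-th coordinate of a combination [u] of translates vanishes at 0,
    then it contributes about [|h * u_k'(0)| ^ r] to the convexity defect
    [(|u(h)| ^ r + |u(-h)| ^ r) / 2 - |(u(h) + u(-h)) / 2| ^ r], which is [O(h ^ 2)];
    so [u_k'(0) = 0]. Hence [g_k'] is a constant multiple of [g_k], and [g_k], being bounded
    on the whole line, is constant.

    If the semigroup is weakly asymptotically contractive, a recurrent two-sided orbit [u] in
    [l^p] has the invariance above, which settles [p < 2]. For [p > 2] the norm is
    differentiable, so that the norming functionals of the points [u(-s)] form a recurrent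
    orbit of the dual semigroup in [l^q], [q = p / (p - 1) < 2]. In both cases [u] is constant.

    An eigenvector [x + iy] for the eigenvalue [ib] gives the periodic orbit
    [cos(bs) x - sin(bs) y]. If the resolvent is compact, then all orbits converge along every
    ultrafilter [F] that tends to infinity; the limits of [T (t + s) x] along [F] form, as
    [s] varies, a recurrent two-sided orbit, hence a fixed point [Q x], and
    [T t (x - Q x)] tends to 0 along [F], thus as [t] tends to infinity. *)

Require Import Defs.
From HB Require Import structures.
From mathcomp Require Import all_boot all_order all_algebra.
From mathcomp Require Import complex ring lra.
From mathcomp Require Import all_classical all_reals all_analysis.
Set Implicit Arguments.
Unset Strict Implicit.
Unset Printing Implicit Defensive.
Import Order.TTheory GRing.Theory Num.Theory.
Import numFieldNormedType.Exports.
Local Open Scope classical_set_scope.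
Local Open Scope ring_scope.

(** * Signed powers and the Hoelder inequality *)

(** The odd extension of [t ^ m]; for [m = p - 1] it is the duality map of [l^p] in each coordinate.
    The factor [Num.sg a] makes it 0 at 0 even for [m = 0], where [0 ^ 0 = 1]. *)
Definition sgpow (R : realType) (m a : R) : R := Num.sg a * `|a| `^ m.

Section signed_power.
Context (R : realType).
Implicit Types (m n p a b : R).

Lemma sgpow_norm_le m a : `|sgpow m a| <= `|a| `^ m.
Proof.
rewrite /sgpow normrM normr_sg (ger0_norm (powR_ge0 _ _)).
by case: eqP => //= _; rewrite ?mul1r ?mul0r ?powR_ge0.
Qed.

Lemma sgpow_norm m a : 0 < m -> `|sgpow m a| = `|a| `^ m.
Proof.
move=> m0; rewrite /sgpow normrM normr_sg (ger0_norm (powR_ge0 _ _)).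
have [->|a0] := eqVneq a 0; first by rewrite normr0 powR0 ?gt_eqF// mulr0.
by rewrite mul1r.
Qed.

Lemma mul_sgpow p a : 0 < p -> sgpow (p - 1) a * a = `|a| `^ p.
Proof.
move=> p0; rewrite /sgpow -(@mulr_powRB1 _ `|a| p)//.
by rewrite mulrAC -normrEsg.
Qed.

Lemma sgpow_comp m n a : 0 < m -> sgpow n (sgpow m a) = sgpow (m * n) a.
Proof.
move=> m0; rewrite {1}/sgpow sgpow_norm// -powRrM /sgpow.
have [->|a0] := eqVneq a 0; first by rewrite sgr0 mul0r sgr0.
by rewrite sgrM sgr_id (@gtr0_sg _ (_ `^ _)) ?mulr1// powR_gt0// normr_gt0.
Qed.

Lemma sgpow1 a : sgpow 1 a = a.
Proof. by rewrite /sgpow powRr1// -numEsg. Qed.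

Lemma sgpowN m a : sgpow m (- a) = - sgpow m a.
Proof. by rewrite /sgpow sgrN normrN mulNr. Qed.

(** The graph of the convex function [t ^ p] lies above its tangent at [a]. Written without the
    conjugate exponent, the inequality includes [p = 1]. *)
Lemma young p a b : 1 <= p -> 0 <= a -> 0 <= b ->
  p * (a `^ (p - 1) * b) <= (p - 1) * a `^ p + b `^ p.
Proof.
move=> p1 a0 b0; have [<-|p1'] := eqVneq 1 p.
  by rewrite subrr powRr0 !mul1r mul0r add0r powRr1.
have {p1 p1'} p1 : 1 < p by rewrite lt_neqAle p1'.
have p0 : 0 < p by apply: lt_trans p1.
have q0 : 0 < p - 1 by rewrite subr_gt0.
have := @conjugate_powR _ (a `^ (p - 1)) b (p / (p - 1)) p (powR_ge0 _ _) b0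
  (divr_gt0 p0 q0) p0.
rewrite -powRrM mulrCA divff ?gt_eqF// mulr1 invf_div => h.
rewrite -ler_pdivlMl//; apply: le_trans (h _) _.
  by rewrite -[X in _ + X]div1r -mulrDl subrK divff ?gt_eqF.
by rewrite le_eqVlt; apply/orP; left; apply/eqP; field; rewrite !gt_eqF.
Qed.

(** Normalise to [A = B = 1] and sum Young's inequality. The power [p - 1] on [F] absorbs the
    conjugate exponent, so that [p = 1] is covered. *)
Lemma holder_sum (I : Type) (s : seq I) (P : pred I) (F G : I -> R) p A B : 1 <= p ->
  (forall i, P i -> 0 <= F i) -> (forall i, P i -> 0 <= G i) ->
  0 <= A -> 0 <= B ->
  \sum_(i <- s | P i) F i `^ p <= A `^ p -> \sum_(i <- s | P i) G i `^ p <= B `^ p ->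
  \sum_(i <- s | P i) F i `^ (p - 1) * G i <= A `^ (p - 1) * B.
Proof.
move=> p1 F0 G0.
have p0 : 0 < p by apply: lt_le_trans p1.
(* The normalisation divides by [A] and [B]; bounds that may vanish are reached by letting [e] tend
   to 0 in [A + e] and [B + e]. *)
wlog suff : A B / 0 < A -> 0 < B ->
  \sum_(i <- s | P i) F i `^ p <= A `^ p -> \sum_(i <- s | P i) G i `^ p <= B `^ p ->
  \sum_(i <- s | P i) F i `^ (p - 1) * G i <= A `^ (p - 1) * B.
  move=> h A0 B0 FA GB.
  have cA : (A + e) `^ (p - 1) * (B + e) @[e --> 0^'+] --> A `^ (p - 1) * B.
    apply: cvgM; last first.
      rewrite -[X in _ --> X]addr0; apply: cvgD; first exact: cvg_cst.
      by apply: cvg_at_right_filter; exact: cvg_id.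
    have [->|p1'] := eqVneq p 1.
      rewrite subrr powRr0; under eq_fun do rewrite powRr0; exact: cvg_cst.
    have q0 : 0 < p - 1 by rewrite subr_gt0 lt_neqAle eq_sym p1'.
    have hA : (A + e) @[e --> 0^'+] --> A.
      rewrite -[X in _ --> X]addr0; apply: cvgD; first exact: cvg_cst.
      by apply: cvg_at_right_filter; exact: cvg_id.
    have [A1|A1] := eqVneq A 0; last first.
      have /differentiable_continuous c : differentiable (fun x => powR x (p - 1)) A.
        apply/derivable1_diffP; apply: derivable_powR.
        by rewrite in_itv/= andbT lt_neqAle eq_sym A1.
      exact: (@cvg_comp _ _ _ (fun e => A + e) (fun x => powR x (p - 1)) _ _ _ hA c).
    rewrite A1 powR0 ?gt_eqF//; under eq_fun do rewrite add0r.
    by apply: powR_cvg0.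
  apply: (cvgr_to_ge cA).
  near=> e.
  have e0 : 0 < e by near: e; exact: nbhs_right_gt.
  apply: h.
  - by rewrite ltr_wpDl.
  - by rewrite ltr_wpDl.
  - by apply: le_trans FA _; apply: ge0_ler_powR; rewrite ?nnegrE ?addr_ge0 ?(ltW p0) ?lerDl ?(ltW e0).
  - by apply: le_trans GB _; apply: ge0_ler_powR; rewrite ?nnegrE ?addr_ge0 ?(ltW p0) ?lerDl ?(ltW e0).
move=> A0 B0 FA GB.
rewrite -[leRHS]mulr1 -ler_pdivrMl ?mulr_gt0 ?powR_gt0// mulr_sumr.
rewrite -(@ler_pM2l _ p)// mulr1 mulr_sumr.
have -> : p = (p - 1) * 1 + 1 by rewrite mulr1 subrK.
have e1 : \sum_(i <- s | P i) (F i / A) `^ p <= 1.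
  under eq_bigr => i Pi.
    rewrite powRM ?F0 ?invr_ge0 ?(ltW A0)// -powR_inv1 ?(ltW A0)// powRAC powR_inv1 ?powR_ge0//.
    over.
  by rewrite -mulr_suml ler_pdivrMr ?powR_gt0// mul1r.
have e2 : \sum_(i <- s | P i) (G i / B) `^ p <= 1.
  under eq_bigr => i Pi.
    rewrite powRM ?G0 ?invr_ge0 ?(ltW B0)// -powR_inv1 ?(ltW B0)// powRAC powR_inv1 ?powR_ge0//.
    over.
  by rewrite -mulr_suml ler_pdivrMr ?powR_gt0// mul1r.
apply: le_trans (_ : (p - 1) * \sum_(i <- s | P i) (F i / A) `^ p + \sum_(i <- s | P i) (G i / B) `^ p <= _); last first.
  by rewrite lerD// ler_wpM2l// subr_ge0.
rewrite mulr_sumr -big_split/= ler_sum// => i Pi; rewrite mulr1 subrK.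
apply: le_trans (young p1 _ _); rewrite ?divr_ge0 ?F0 ?G0 ?(ltW A0) ?(ltW B0)//.
rewrite ler_pM2l//.
rewrite [(_ / A) `^ _]powRM ?F0 ?invr_ge0 ?(ltW A0)// -(powR_inv1 (ltW A0)) powRAC powR_inv1 ?powR_ge0//.
rewrite le_eqVlt; apply/orP; left; apply/eqP; field.
by rewrite !gt_eqF ?powR_gt0.
Unshelve. all: by end_near. Qed.

End signed_power.

(** * The duality map of [l^p] *)

(** On a divergent series [limn] is a default value; [dot_bound] supplies the absolute convergence
    behind the estimates and the linearity. *)
Definition dot (R : realType) (c w : nat -> R) : R :=
  limn (series (fun k => c k * w k)).

Section dot.
Context (R : realType).
Implicit Types (c w : nat -> R) (C : R).

Definition dot_bound c w C := forall n, \sum_(0 <= k < n) `|c k * w k| <= C.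

Lemma dot_cvg c w C : dot_bound c w C ->
  series (fun k => c k * w k) @ \oo --> dot c w.
Proof.
move=> h; apply/cvg_ex; exists (dot c w).
suff : cvgn (series (fun k => c k * w k)) by [].
apply: normed_cvg; apply: nondecreasing_is_cvgn.
  by apply: nondecreasing_series => n _ _ /=.
by exists C => _ [n _ <-]; exact: h.
Qed.

Lemma dot_le c w C : dot_bound c w C -> `|dot c w| <= C.
Proof.
move=> h; apply: (cvgr_to_le (cvg_norm (dot_cvg h))).
apply: nearW => n; apply: le_trans (h n).
exact: ler_norm_sum.
Qed.

Lemma dotC c w : dot c w = dot w c.
Proof. by rewrite /dot; under eq_fun do rewrite mulrC. Qed.

Lemma dotDr c w w' C C' : dot_bound c w C -> dot_bound c w' C' ->
  dot c (fun k => w k + w' k) = dot c w + dot c w'.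
Proof.
move=> /dot_cvg h /dot_cvg h'; apply/cvg_lim => //.
have -> : series (fun k => c k * (w k + w' k)) =
   series (fun k => c k * w k) + series (fun k => c k * w' k).
  by rewrite -seriesD; congr series; apply/funext => k; rewrite mulrDr.
exact: cvgD.
Qed.

Lemma dotZr c w a C : dot_bound c w C -> dot c (fun k => a * w k) = a * dot c w.
Proof.
move=> /dot_cvg h; apply/cvg_lim => //.
have -> : series (fun k => c k * (a * w k)) = a *: series (fun k => c k * w k).
  by rewrite -seriesZ; congr series; apply/funext => k /=; rewrite mulrCA.
by apply: cvgZl_tmp; exact: h.
Qed.

End dot.

Arguments lp_seq : simpl never.

Section lp_theory.
Context (R : realType) (p : R) (p1 : 1 <= p).
Local Notation E := (lp p1).
Implicit Types (u w x y : E) (k n : nat).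

Let p0 : 0 < p. Proof. exact: lt_le_trans p1. Qed.

Lemma lp_seqP x y : (forall k, lp_seq x k = lp_seq y k) -> x = y.
Proof. by move=> h; apply/(@LfuneqP _ _ _ counting p%:E p1) => k; exact: h. Qed.

Lemma lp_seqD x y k : lp_seq (x + y) k = lp_seq x k + lp_seq y k.
Proof. by []. Qed.

Lemma lp_seqN x k : lp_seq (- x) k = - lp_seq x k.
Proof. by []. Qed.

Lemma lp_seqB x y k : lp_seq (x - y) k = lp_seq x k - lp_seq y k.
Proof. by []. Qed.

Lemma lp_seqZ (a : R) x k : lp_seq (a *: x) k = a * lp_seq x k.
Proof. by []. Qed.

Lemma lp_seq0 k : lp_seq (0 : E) k = 0.
Proof. by rewrite -[0 in LHS](subrr (0 : E)) lp_seqB subrr. Qed.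

Lemma lp_coord_norm x k : `|lp_seq x k| <= `|x|.
Proof. exact: lp_coord_le. Qed.

Lemma lp_psum_le x n : \sum_(0 <= k < n) `|lp_seq x k| `^ p <= `|x| `^ p.
Proof. exact: lp_sum_le. Qed.

Lemma lp_psum_cvg x :
  series (fun k => `|lp_seq x k| `^ p) @ \oo --> `|x| `^ p.
Proof.
have := lp_normE x; rewrite -[lp_norm x]/`|x| => h.
have cv : cvgn (series (fun k => `|lp_seq x k| `^ p)).
  apply: nondecreasing_is_cvgn.
    by apply: nondecreasing_series => n _ _; exact: powR_ge0.
  by exists (`|x| `^ p) => _ [n _ <-]; exact: lp_psum_le.
suff <- : limn (series (fun k => `|lp_seq x k| `^ p)) = `|x| `^ p by [].
apply: EFin_inj; rewrite h -EFin_lim//; congr (limn _).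
by apply/funext => n /=; rewrite sumEFin.
Qed.

Lemma lp_norm_le x (C : R) : 0 <= C ->
  (forall n, \sum_(0 <= k < n) `|lp_seq x k| `^ p <= C `^ p) -> `|x| <= C.
Proof.
move=> C0 /(lp_bounded_sum p1 C0)[y yx yC].
by rewrite (_ : x = y)//; apply: lp_seqP => k; rewrite yx.
Qed.

Lemma lp_dominated (s : nat -> R) w :
  (forall k, `|s k| <= `|lp_seq w k|) -> exists2 x : E, lp_seq x = s & `|x| <= `|w|.
Proof.
move=> h; apply: lp_bounded_sum => // n; apply: le_trans (lp_psum_le w n).
by apply: ler_sum => i _; apply: ge0_ler_powR; rewrite ?nnegrE ?(ltW p0).
Qed.

Lemma lp_norm_dominated x w :
  (forall k, `|lp_seq x k| <= `|lp_seq w k|) -> `|x| <= `|w|.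
Proof.
move=> /lp_dominated[y yx yw].
by rewrite (_ : x = y)//; apply: lp_seqP => k; rewrite yx.
Qed.

Lemma lp_abs x : exists2 y : E, lp_seq y = (fun k => `|lp_seq x k|) & `|y| = `|x|.
Proof.
have [|y yx yle] := @lp_dominated (fun k => `|lp_seq x k|) x.
  by move=> k; rewrite normr_id.
exists y => //; apply/eqP; rewrite eq_le yle/=.
by apply: lp_norm_dominated => k; rewrite yx normr_id.
Qed.

Lemma lp_delta k : exists2 x : E, lp_seq x = (fun j => (j == k)%:R) & `|x| <= 1.
Proof.
apply: lp_bounded_sum => // n; rewrite powR1.
apply: le_trans (_ : \sum_(0 <= j < n | j == k) (1 : R) <= _).
  rewrite [leRHS]big_mkcond/=; apply: ler_sum => j _.
  by case: eqP => _; rewrite ?normr1 ?powR1// normr0 powR0 ?gt_eqF.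
by rewrite big_nat1_eq; case: ifP.
Qed.

(* Normed so that the functional [dual_map u] has norm [|u| ^ (p - 1)]. *)
Definition dual_map (u w : E) : R :=
  dot (fun k => sgpow (p - 1) (lp_seq u k)) (lp_seq w).

Lemma dual_map_bound u w :
  dot_bound (fun k => sgpow (p - 1) (lp_seq u k)) (lp_seq w)
    (`|u| `^ (p - 1) * `|w|).
Proof.
move=> n; apply: le_trans (_ : \sum_(0 <= k < n)
    `|lp_seq u k| `^ (p - 1) * `|lp_seq w k| <= _).
  by apply: ler_sum => k _; rewrite normrM ler_wpM2r// sgpow_norm_le.
by apply: holder_sum => //; exact: lp_psum_le.
Qed.

Lemma dual_map_le u w : `|dual_map u w| <= `|u| `^ (p - 1) * `|w|.
Proof. exact/dot_le/dual_map_bound. Qed.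

Lemma dual_map_self u : dual_map u u = `|u| `^ p.
Proof.
apply/cvg_lim => //; under eq_fun do rewrite mul_sgpow//.
exact: lp_psum_cvg.
Qed.

Lemma dual_map_is_linear u : linear_for *%R (dual_map u).
Proof.
move=> a x y; rewrite /dual_map.
have -> : lp_seq (a *: x + y) = (fun k => lp_seq (a *: x) k + lp_seq y k) by [].
rewrite (dotDr (@dual_map_bound u (a *: x)) (@dual_map_bound u y)).
by congr +%R; exact: dotZr (@dual_map_bound u x).
Qed.

HB.instance Definition _ (u : E) :=
  GRing.isLinear.Build R E R *%R (dual_map u) (dual_map_is_linear u).

Lemma dual_mapD u x y : dual_map u (x + y) = dual_map u x + dual_map u y.
Proof. exact: linearD. Qed.

Lemma dual_mapN u x : dual_map u (- x) = - dual_map u x.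
Proof. exact: linearN. Qed.

Lemma dual_mapZ u (a : R) x : dual_map u (a *: x) = a * dual_map u x.
Proof. exact: linearZ. Qed.

End lp_theory.

(** * Rigidity of stationary curves *)

Section rigidity_smooth.
Context (R : realType) (r : R) (r1 : 1 <= r).
Local Notation E := (lp r1).

Let r0 : 0 < r. Proof. exact: lt_le_trans r1. Qed.

(** Add the tangent inequalities for [t ^ r] at the modulus of the midpoint, evaluated at [|a|] and
    [|b|]. *)
Lemma powR_midpoint_le (a b : R) :
  `|2^-1 * (a + b)| `^ r <= 2^-1 * (`|a| `^ r + `|b| `^ r).
Proof.
set c := `| _ |.
have c0 : 0 <= c by rewrite /c.
have ya := young r1 c0 (normr_ge0 a); have yb := young r1 c0 (normr_ge0 b).
have h : r * (c `^ (r - 1) * (2 * c)) <= r * (c `^ (r - 1) * (`|a| + `|b|)).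
  rewrite ler_pM2l// ler_wpM2l ?powR_ge0// /c normrM ger0_norm ?invr_ge0//.
  by rewrite mulrA divff// mul1r ler_normD.
have e : c * c `^ (r - 1) = c `^ r by rewrite mulr_powRB1.
nra.
Qed.

(** The convexity defect of the norm is a sum of coordinate defects, all nonnegative; all but the
    [k]-th are dropped. *)
Lemma lp_midpoint (x y : E) k :
  `|2^-1 *: (x + y)| `^ r + `|2^-1 * lp_seq (x - y) k| `^ r <=
  2^-1 * (`|x| `^ r + `|y| `^ r) + `|2^-1 * lp_seq (x + y) k| `^ r.
Proof.
rewrite -lerBrDr.
apply: (cvgr_to_le (@lp_psum_cvg _ _ r1 (2^-1 *: (x + y)))).
exists k.+1 => // n /= kn.
rewrite lerBrDr -lerBrDl.
apply: le_trans (_ : \sum_(0 <= j < n) (2^-1 * (`|lp_seq x j| `^ r + `|lp_seq y j| `^ r)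
   - `|2^-1 * lp_seq (x + y) j| `^ r) + `|2^-1 * lp_seq (x + y) k| `^ r <= _); last first.
  rewrite sumrB -mulr_sumr big_split/= lerBrDr.
  have -> : \sum_(0 <= j < n) `|2^-1 * lp_seq (x + y) j| `^ r =
      series (fun j => `|lp_seq (2^-1 *: (x + y)) j| `^ r) n by [].
  rewrite addrAC subrK.
  by rewrite lerD2r ler_wpM2l// lerD// lp_psum_le.
rewrite big_mkord (bigD1 (Ordinal kn))//=.
rewrite addrAC subrK ler_wpDr//.
  by apply: sumr_ge0 => j _; rewrite subr_ge0; exact: powR_midpoint_le.
(* Midpoint convexity at [x_k] and [- y_k] brings in the difference. *)
by have := powR_midpoint_le (lp_seq x k) (- lp_seq y k); rewrite normrN.
Qed.

(* The entries of [l] are pairs (coefficient, shift). *)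
Definition combo (g : R -> E) (l : seq (R * R)) (s : R) : E :=
  \sum_(i <- l) i.1 *: g (s + i.2).

Definition stationary (g : R -> E) : Prop :=
  forall l s, `|combo g l s| = `|combo g l 0|.

Lemma stationary_norm g : stationary g -> forall s, `|g s| = `|g 0|.
Proof.
move=> st s; have := st [:: (1, 0)] s.
by rewrite /combo !big_seq1/= !addr0 !scale1r.
Qed.

Lemma stationary_dist g : stationary g ->
  forall a b s, `|g (s + a) - g (s + b)| = `|g a - g b|.
Proof.
move=> st a b s; have := st [:: (1, a); (-1, b)] s.
by rewrite /combo !big_cons !big_nil/= !addr0 !scale1r !scaleN1r !add0r.
Qed.

(** If [l] is not 0, take [l * s = B / |c|]: then [1 + t <= exp t] gives [|c| + B <= B]. *)
Lemma exp_growth_unbounded (c l B : R) : c != 0 ->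
  (forall s, `|c * expR (l * s)| <= B) -> l = 0.
Proof.
move=> c0 h; apply/eqP; apply/negP => /negP l0.
have := h ((B / `|c|) / l); rewrite mulrCA divff// mulr1.
rewrite normrM [`|expR _|]ger0_norm ?expR_ge0// => h1.
have := expR_ge1Dx (B / `|c|) => h2.
have := le_trans (ler_wpM2l (normr_ge0 c) h2) h1.
by rewrite mulrDr mulr1 mulrCA divff ?normr_eq0// mulr1 gerDr leNgt normr_gt0 c0.
Qed.

(** At a point [b] with [f b != 0] the last hypothesis reads [f' = l f], so [f] is a multiple of
    [exp (l s)]; boundedness on the whole line forces [l = 0]. *)
Lemma proportional_derivative_cst (f df : R -> R) (B : R) :
  (forall s : R, is_derive s (1 : R) f (df s)) -> (forall s, `|f s| <= B) ->
  (forall a b, f b * df a = f a * df b) -> forall s t, f s = f t.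
Proof.
move=> fd fB fp.
have [f0|] := pselect (forall s, f s = 0); first by move=> s t; rewrite !f0.
move=> /existsNP[b /eqP fb].
pose l := df b / f b.
have dfE a : df a = l * f a.
  by rewrite /l; apply: (mulfI fb); rewrite fp mulrA mulrCA divff// mulr1 mulrC.
have cst s t : f s * expR (- l * s) = f t * expR (- l * t).
  apply: (@is_derive_0_is_cst _ (fun s => f s * expR (- l * s))) => x.
  have ide : is_derive x (1 : R) (fun s : R => expR (- l * s)) (- l * expR (- l * x)).
    have h1 : is_derive x (1 : R) (fun s : R => - l * s) (- l).
      by apply: is_derive_eq; rewrite /GRing.scale/= mulr1.
    have := @is_derive1_comp _ expR (fun s : R => - l * s) x _ _ (is_derive_expR _) h1.
    by rewrite mulrC.
  have := @is_deriveM _ _ f (fun s => expR (- l * s)) x 1 _ _ (fd x) ide.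
  move=> h; apply: (is_derive_eq h); rewrite dfE /GRing.scale/=; ring.
pose c := f b * expR (- l * b).
have fE s : f s = c * expR (l * s).
  by rewrite /c (cst b s) -mulrA -expRD mulNr addNr expR0 mulr1.
have c0 : c != 0 by rewrite /c mulf_neq0// gt_eqF// expR_gt0.
have l0 : l = 0.
  by apply: (@exp_growth_unbounded c _ B) => // s; rewrite -fE.
by move=> s t; rewrite !fE l0 !mul0r.
Qed.

(* In [l^r], [r < 2], the term [|h| ^ r] contributed by a coordinate with a simple zero
   beats the error [O(h ^ 2)] of the parallelogram defect of the whole. *)
Lemma stationary_smooth_cst (g : R -> E) (dg : nat -> R -> R) (C : R) : r < 2 ->
  stationary g ->
  (forall s h, `|g (s + h) + g (s - h) - 2 *: g s| <= C * h ^+ 2) ->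
  (forall k (s : R), is_derive s (1 : R) (fun t => lp_seq (g t) k) (dg k s)) ->
  forall s t, g s = g t.
Proof.
move=> r2 st g2 gd s t; apply: lp_seqP => k; move: s t.
apply: (@proportional_derivative_cst _ (dg k) `|g 0|) => [s|a b].
- by rewrite -(stationary_norm st s) lp_coord_norm.
pose f s := lp_seq (g s) k; rewrite -!/(f _).
have C0 : 0 <= C by have := g2 0 1; rewrite expr1n mulr1; apply: le_trans.
(* A combination of translates whose [k]-th coordinate vanishes at [h = 0] and has derivative [D]
   there; by stationarity its norm is constant. *)
pose u h := f b *: g (a + h) - f a *: g (b + h).
pose N := `|u 0|.
have uN h : `|u h| = N.
  have := st [:: (f b, a); (- f a, b)] h.
  rewrite /combo !big_cons !big_nil/= !addr0 !scaleNr !add0r.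
  by rewrite /N /u !addr0 ![h + _]addrC.
pose K := (`|f b| + `|f a|) * C.
have K0 : 0 <= K by rewrite mulr_ge0// addr_ge0.
have u2 h : `|u h + u (- h) - 2 *: u 0| <= K * h ^+ 2.
  have -> : u h + u (- h) - 2 *: u 0 =
    f b *: (g (a + h) + g (a - h) - 2 *: g a) - f a *: (g (b + h) + g (b - h) - 2 *: g b).
    apply: lp_seqP => j; rewrite /u !addr0.
    by rewrite !(lp_seqD, lp_seqN, lp_seqZ); ring.
  apply: le_trans (ler_normB _ _) _; rewrite !normrZ /K -mulrA mulrDl.
  by rewrite lerD// ler_wpM2l// g2.
pose D := f b * dg k a - f a * dg k b.
suff : D = 0 by move=> /eqP; rewrite subr_eq0 => /eqP.
have uk0 : lp_seq (u 0) k = 0.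
  by rewrite /u !addr0 lp_seqB !lp_seqZ -!/(f _) mulrC subrr.
(* The first term bounds [N ^ r - |m| ^ r], by the tangent inequality and [N <= |m| + K h ^ 2]. The
   second bounds the [k]-th coordinate of the midpoint [m], as [(h ^ 2) ^ r <= h ^ 2] for
   [h <= 1]. *)
pose C' := r * N `^ (r - 1) * K + K `^ r.
have key h : 0 < h -> h <= 1 ->
    `|2^-1 * lp_seq (u h - u (- h)) k| `^ r <= C' * h ^+ 2.
  move=> h0 h1; have := lp_midpoint (u h) (u (- h)) k.
  rewrite !uN; set m := 2^-1 *: _; set d := `|2^-1 * _|.
  have -> : 2^-1 * (N `^ r + N `^ r) = N `^ r by field.
  have h20 : 0 <= h ^+ 2 by apply: sqr_ge0.
  have h21 : h ^+ 2 <= 1 by rewrite expr_le1// ltW.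
  have mu0 : `|m - u 0| <= K * h ^+ 2.
    have -> : m - u 0 = 2^-1 *: (u h + u (- h) - 2 *: u 0).
      by rewrite scalerBr scalerA mulVf// scale1r.
    rewrite normrZ ger0_norm ?invr_ge0//; apply: le_trans (u2 h).
    by rewrite ler_piMl// invf_le1// ler1n.
  have mN : N <= `|m| + K * h ^+ 2.
    rewrite /N -[u 0](subKr m); apply: le_trans (ler_normB _ _) _.
    by rewrite lerD2l.
  have mk : `|2^-1 * lp_seq (u h + u (- h)) k| <= K * h ^+ 2.
    rewrite -lp_seqZ -/m; apply: le_trans mu0.
    have -> : lp_seq m k = lp_seq (m - u 0) k by rewrite lp_seqB uk0 subr0.
    exact: lp_coord_norm.
  have {}mk : `|2^-1 * lp_seq (u h + u (- h)) k| `^ r <= K `^ r * h ^+ 2.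
    apply: le_trans (_ : (K * h ^+ 2) `^ r <= _).
      by apply: ge0_ler_powR mk; rewrite ?(ltW r0)// nnegrE mulr_ge0.
    rewrite powRM// ler_wpM2l ?powR_ge0//.
    by rewrite ge1r_powR// h21 exprn_gt0.
  have yN := young r1 (normr_ge0 (u 0)) (normr_ge0 m).
  rewrite -/N in yN => main.
  have NN : N * N `^ (r - 1) = N `^ r by rewrite mulr_powRB1// normr_ge0.
  have NK : r * N `^ (r - 1) * N <= r * N `^ (r - 1) * (`|m| + K * h ^+ 2).
    apply: ler_wpM2l => //; apply: mulr_ge0; [exact: ltW|exact: powR_ge0].
  rewrite /C'; nra.
have dq (e : R) c : e = 1 \/ e = -1 ->
    (e * h)^-1 * (f (c + e * h) - f c) @[h --> 0^'+] --> dg k c.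
  move=> e1; have [dr dv] := gd k c.
  have hc : h^-1 * (f (c + h) - f c) @[h --> 0^'] --> dg k c.
    rewrite -dv; apply: cvg_trans dr; apply: near_eq_cvg; near=> h.
    by rewrite /= /GRing.scale/= mulr1 [c + _]addrC.
  apply/cvgrPdist_lt => d d0.
  move/cvgrPdist_lt : hc => /(_ d d0); rewrite near_withinE => /nbhs_ballP[x /= x0 H].
  near=> h; have h0 : 0 < h by near: h; exact: nbhs_right_gt.
  have en : `|e| = 1 by case: e1 => ->; rewrite ?normrN normr1.
  have hx : h < x by near: h; exact: nbhs_right_lt.
  apply: H => /=; last by rewrite mulf_eq0 -normr_eq0 en oner_eq0 gt_eqF.
  by rewrite -ball_normE/= sub0r normrN normrM en mul1r gtr0_norm.
have uD : h^-1 * (2^-1 * lp_seq (u h - u (- h)) k) @[h --> 0^'+] --> D.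
  have dqD c : h^-1 * (2^-1 * (f (c + h) - f (c - h))) @[h --> 0^'+] --> dg k c.
    have : 2^-1 * ((1 * h)^-1 * (f (c + 1 * h) - f c) +
        (-1 * h)^-1 * (f (c + -1 * h) - f c)) @[h --> 0^'+] --> 2^-1 * (dg k c + dg k c).
      by apply: cvgM; [exact: cvg_cst|apply: cvgD; apply: dq; [left|right]].
    rewrite (_ : 2^-1 * (dg k c + dg k c) = dg k c); last by field.
    apply: cvg_trans; apply: near_eq_cvg; near=> h => /=.
    rewrite mul1r mulN1r; field.
    by near: h; exact: nbhs_right_neq.
  have : f b * (h^-1 * (2^-1 * (f (a + h) - f (a - h)))) -
      f a * (h^-1 * (2^-1 * (f (b + h) - f (b - h)))) @[h --> 0^'+] --> D.
    by apply: cvgB; (apply: cvgM; [exact: cvg_cst|exact: dqD]).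
  apply: cvg_trans; apply: near_eq_cvg; near=> h => /=.
  by rewrite /u !(lp_seqB, lp_seqZ) -!/(f _); ring.
have C'0 : 0 <= C'.
  by rewrite /C' addr_ge0 ?powR_ge0// mulr_ge0 ?mulr_ge0 ?powR_ge0 ?(ltW r0).
(* The [r]-th root of [key] divided by [h]. Since [r < 2], the exponent [2 / r - 1] is positive and
   the bound tends to 0. *)
have Dle : \forall h \near 0^'+,
    `|h^-1 * (2^-1 * lp_seq (u h - u (- h)) k)| <= C' `^ r^-1 * h `^ (2 / r - 1).
  near=> h.
  have h0 : 0 < h by near: h; exact: nbhs_right_gt.
  have h1 : h <= 1 by near: h; exact: nbhs_right_le.
  have kh := ge0_ler_powR (ltW (_ : 0 < r^-1)) (powR_ge0 _ _) _ (key h h0 h1).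
  rewrite normrM normfV (gtr0_norm h0) ler_pdivrMl//.
  have := kh; rewrite -powRrM divff ?gt_eqF// powRr1// => /(_ _ _)/le_trans; apply.
  - by rewrite invr_gt0.
  - by rewrite nnegrE mulr_ge0// sqr_ge0.
  rewrite powRM ?sqr_ge0// -(powR_mulrn _ (ltW h0)) -powRrM mulrCA.
  by rewrite mulr_powRB1 ?(ltW h0)// divr_gt0.
have b0 : C' `^ r^-1 * h `^ (2 / r - 1) @[h --> 0^'+] --> 0.
  rewrite -[X in _ --> X](mulr0 (C' `^ r^-1)); apply: cvgM; first exact: cvg_cst.
  by apply: powR_cvg0; rewrite subr_gt0 ltr_pdivlMr// mul1r.
have : C' `^ r^-1 * h `^ (2 / r - 1) - `|h^-1 * (2^-1 * lp_seq (u h - u (- h)) k)|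
    @[h --> 0^'+] --> 0 - `|D| by apply: cvgB => //; exact: cvg_norm.
rewrite sub0r => /cvgr_to_ge h.
apply/eqP; rewrite -normr_le0 -oppr_ge0; apply: h.
by apply: filterS Dle => h /=; rewrite subr_ge0.
Unshelve. all: by end_near. Qed.

End rigidity_smooth.

(** * Antiderivatives of real functions and of curves in [l^r] *)

Section antiderivative.
Context (R : realType).
Local Notation mu := (@lebesgue_measure R).

Lemma continuous_antiderivative (f : R -> R) : continuous f ->
  exists F : R -> R, forall x : R, is_derive x (1 : R) F (f x).
Proof.
move=> cf.
have fint (a b : R) : mu.-integrable `[a, b] (EFin \o f).
  apply: continuous_compact_integrable; first exact: segment_compact.
  exact: continuous_subspaceT.
pose I (a x : R) := \int[mu]_(t in `[a, x]) f t.
have IB (a b x : R) : a <= b -> b <= x -> I a x = I a b + I b x.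
  move=> ab bx; rewrite addrC; apply/eqP; rewrite -subr_eq; apply/eqP.
  rewrite /I (Rintegral_itvB (fint a x)) ?bnd_simp//.
  rewrite Rintegral_itv_obnd_cbnd//.
  by apply: integrableS (fint b x) => //; apply: subset_itvr; rewrite bnd_simp.
(* Normalised to vanish at 0, the integrals from [-n] agree wherever two of them are meaningful, and
   so glue to one function on the line. *)
pose G (n : nat) (x : R) := I (- n%:R) x - I (- n%:R) 0.
have GE (m n : nat) x : (m <= n)%N -> - m%:R <= x -> G n x = G m x.
  move=> mn mx.
  have nm : - n%:R <= - m%:R :> R by rewrite lerN2 ler_nat.
  have m0 : - m%:R <= 0 :> R by rewrite oppr_le0.
  by rewrite /G (IB _ _ x nm mx) (IB _ _ 0 nm m0); ring.
have dG (n : nat) (x : R) : `|x| < n%:R -> is_derive x (1 : R) (G n) (f x).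
  rewrite ltr_norml => /andP[nx xn].
  have [d dE] := @continuous_FTC1_closed _ f (- n%:R) x n%:R xn (fint _ _) nx (cf x).
  have d1 : is_derive x (1 : R) (I (- n%:R)) (f x).
    by split; [exact: d|rewrite -derive1E].
  have := @is_deriveB _ _ _ _ (cst (I (- n%:R) 0)) x 1 _ _ d1 (is_derive_cst _ _ _).
  by rewrite subr0.
exists (fun x => G (Num.truncn `|x|).+1 x) => x.
have xM : `|x| < (Num.truncn `|x|).+2%:R.
  by apply: lt_trans (truncnS_gt _) _; rewrite ltr_nat.
(* The index in the glued function may jump near [x]; one index higher dominates those of all nearby
   points. *)
apply: (@near_eq_is_derive _ _ _ (G (Num.truncn `|x|).+2)); last exact: dG.
have : \forall y \near x, `|y| < (Num.truncn `|x|).+2%:R.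
  by exact: (@cvgr_norm_lt R R R (nbhs x) _ id x (@cvg_id _ _) _ xM).
apply: filterS => y yM; apply: GE; first by rewrite ltnS truncn_le_nat.
by have := truncnS_gt `|y|; rewrite ltr_norml => /andP[/ltW].
Qed.

End antiderivative.

Section integration.
Context (R : realType) (r : R) (r1 : 1 <= r).
Local Notation E := (lp r1).

Let r0 : 0 < r. Proof. exact: lt_le_trans r1. Qed.

(* Minkowski's integral inequality, with the mean value theorem for the pairing of the
   increment with its own dual map in place of integration. *)
Lemma increment_psum_le (Phi phi : nat -> R -> R) (a b c : R) (w : nat -> R) n :
  (forall k (s : R), is_derive s (1 : R) (Phi k) (phi k s)) ->
  a < b -> 0 <= c ->
  (forall t, a <= t <= b -> exists2 x : E, `|x| <= c & forall k, lp_seq x k = phi k t - w k) ->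
  \sum_(0 <= k < n) `|Phi k b - Phi k a - (b - a) * w k| `^ r <= ((b - a) * c) `^ r.
Proof.
move=> dPhi ab c0 gc.
pose J k := Phi k b - Phi k a - (b - a) * w k.
pose S := \sum_(0 <= k < n) `|J k| `^ r.
rewrite -/S.
have S0 : 0 <= S by apply: sumr_ge0 => k _; exact: powR_ge0.
have [S00|Sn0] := eqVneq S 0; first by rewrite S00 powR_ge0.
(* The truncated [l^r] norm of [J]. It is positive, so that [A ^ (r - 1)] can be cancelled at the
   end from [A ^ r <= A ^ (r - 1) * c * (b - a)]. *)
pose A := S `^ r^-1.
have A0 : 0 < A by rewrite powR_gt0// lt_neqAle eq_sym Sn0.
have AS : A `^ r = S by rewrite /A -powRrM mulVf ?gt_eqF// powRr1.
have ba0 : 0 < b - a by rewrite subr_gt0.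
suff : A <= (b - a) * c.
  by rewrite -AS => h; apply: ge0_ler_powR; rewrite ?nnegrE ?(ltW r0) ?(ltW A0) ?mulr_ge0 ?(ltW ba0).
pose h (i : 'I_n) (t : R) : R := sgpow (r - 1) (J i) * (Phi i t - t * w i).
pose H := \sum_(i < n) h i.
have dH (t : R) : is_derive t (1 : R) H (\sum_(i < n) sgpow (r - 1) (J i) * (phi i t - w i)).
  apply: is_derive_sum => i.
  have d1 : is_derive t (1 : R) (fun t : R => t * w i) (w i).
    by apply: is_derive_eq; rewrite /GRing.scale/= mulr0 add0r mulr1.
  have d2 := @is_deriveB _ _ _ _ _ t 1 _ _ (dPhi i t) d1.
  have := @is_deriveZ _ _ _ _ (sgpow (r - 1) (J i)) t 1 _ d2.
  by [].
have cH : {within `[a, b], continuous H}.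
  apply: continuous_subspaceT => t.
  by apply: differentiable_continuous; apply/derivable1_diffP; case: (dH t).
have [t tab] := @MVT _ H _ a b ab (fun t _ => dH t) cH.
have -> : H b - H a = S.
  rewrite /H !fct_sumE -sumrB /S big_mkord; apply: eq_bigr => i _.
  by rewrite /h -mulrBr -(mul_sgpow (J i) r0) /J; congr (_ * _); ring.
move: tab; rewrite in_itv/= => /andP[at_ tb] SE.
have [|x xc xE] := gc t; first by rewrite !ltW.
have : S <= A `^ (r - 1) * c * (b - a).
  rewrite SE ler_wpM2r ?(ltW ba0)//.
  apply: le_trans (_ : \sum_(i < n) `|J i| `^ (r - 1) * `|lp_seq x i| <= _).
    apply: ler_sum => i _; apply: le_trans (ler_norm _) _.
    by rewrite normrM -xE ler_wpM2r// sgpow_norm_le.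
  apply: holder_sum => //; first exact: ltW.
    by rewrite AS /S big_mkord.
  rewrite -(big_mkord xpredT (fun i => `|lp_seq x i| `^ r)).
  apply: le_trans (lp_psum_le x n) _.
  by apply: ge0_ler_powR; rewrite ?nnegrE ?(ltW r0).
rewrite -AS -(mulr_powRB1 (ltW A0) r0) mulrC -mulrA (ler_pM2l (powR_gt0 _ A0)).
by rewrite mulrC.
Qed.

(** Stands in for an [l^r]-valued integral: a derivative in each coordinate, and a mean value
    inequality in norm. With [w = 0] the latter gives a Lipschitz bound, with [w] a value of [g] the
    error of a Riemann sum. *)
Definition antiderivative (g G : R -> E) : Prop :=
  (forall k (s : R), is_derive s (1 : R) (fun t => lp_seq (G t) k) (lp_seq (g s) k)) /\
  forall a b c w, a <= b -> 0 <= c -> (forall t, a <= t <= b -> `|g t - w| <= c) ->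
    `|G b - G a - (b - a) *: w| <= (b - a) * c.

Lemma bounded_antiderivative (g : R -> E) (B : R) : continuous g ->
  (forall s, `|g s| <= B) -> exists G, antiderivative g G.
Proof.
move=> cg gB.
have B0 : 0 <= B by apply: le_trans (gB 0).
have /choice[Phi dPhi] : forall k, exists F : R -> R,
    forall x : R, is_derive x (1 : R) F (lp_seq (g x) k).
  move=> k; apply: continuous_antiderivative => x.
  apply/cvgrPdist_lt => e e0; move/cvgrPdist_lt : (cg x) => /(_ e e0).
  apply: filterS => y; rewrite -lp_seqB; apply: le_lt_trans; exact: lp_coord_norm.
have core a b c w n : a <= b -> 0 <= c -> (forall t, a <= t <= b -> `|g t - w| <= c) ->
    \sum_(0 <= k < n) `|Phi k b - Phi k a - (b - a) * lp_seq w k| `^ r <= ((b - a) * c) `^ r.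
  rewrite le_eqVlt => /predU1P[<- c0 _|ab c0 gc].
    rewrite big1 ?powR_ge0// => k _.
    by rewrite !subrr mul0r subr0 normr0 powR0 ?gt_eqF.
  apply: (@increment_psum_le Phi (fun k s => lp_seq (g s) k)) => // t tab.
  by exists (g t - w); [exact: gc|].
(* The increments of the coordinates from 0 to [s] form an element of [l^r]: [core] with [w = 0] and
   [c = B] bounds their partial sums. *)
have /choice[G GE] : forall s, exists x : E, lp_seq x = (fun k => Phi k s - Phi k 0).
  move=> s; have gB' : forall t, `|g t - 0| <= B by move=> t; rewrite subr0.
  have [||x xE _] := @lp_bounded_sum _ _ r1 (fun k => Phi k s - Phi k 0) (`|s| * B).
  - by rewrite mulr_ge0.
  - move=> n; have [s0|s0] := leP 0 s.
      have := core 0 s B 0 n s0 B0 (fun t _ => gB' t).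
      rewrite subr0; under eq_bigr do rewrite lp_seq0 mulr0 subr0.
      by rewrite ger0_norm.
    have := core s 0 B 0 n (ltW s0) B0 (fun t _ => gB' t).
    rewrite sub0r; under eq_bigr do rewrite lp_seq0 mulr0 subr0 distrC.
    by rewrite ltr0_norm.
  - by exists x.
exists G; split.
  move=> k s; have -> : (fun t => lp_seq (G t) k) = (Phi k - cst (Phi k 0)).
    by apply/funext => t; rewrite GE.
  by have := @is_deriveB _ _ _ _ (cst (Phi k 0)) s 1 _ _ (dPhi k s) (is_derive_cst _ _ _);
     rewrite subr0.
move=> a b c w ab c0 gc; apply: lp_norm_le; first by rewrite mulr_ge0// subr_ge0.
move=> n; apply: le_trans (core a b c w n ab c0 gc).
apply: ler_sum => k _; rewrite !lp_seqB lp_seqZ !GE.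
by rewrite le_eqVlt; apply/orP; left; apply/eqP; congr (`|_| `^ _); ring.
Qed.

End integration.

(** * Smoothing of stationary curves *)

Section rigidity.
Context (R : realType) (r : R) (r1 : 1 <= r).
Local Notation E := (lp r1).
Implicit Types (g G : R -> E).

Let is_derive_shift (f : R -> R) (b s d : R) : is_derive (s + b) (1 : R) f d ->
  is_derive s (1 : R) (fun t => f (t + b)) d.
Proof.
move=> fd; have sd : is_derive s (1 : R) (fun t : R => t + b) 1.
  by apply: is_derive_eq; rewrite addr0.
by have := @is_derive1_comp _ f (fun t => t + b) s _ _ fd sd; rewrite mulr1.
Qed.

(** The distance of [g s] and [g t] depends on [t - s] only, so continuity at 0 is uniform
    continuity. *)
Lemma stationary_uniform g : stationary g -> {for 0, continuous g} ->
  forall e, 0 < e -> exists2 d, 0 < d & forall s t, `|s - t| < d -> `|g s - g t| <= e.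
Proof.
move=> st /cvgrPdist_lt c0 e /c0 /nbhs_ballP[d /= d0 H].
exists d => // s t st_d; have := stationary_dist st 0 (t - s) s.
rewrite addr0 subrKC => ->; apply/ltW; apply: H.
by rewrite -ball_normE/= sub0r normrN distrC.
Qed.

Lemma stationary_continuous g : stationary g -> {for 0, continuous g} -> continuous g.
Proof.
move=> st c0 s; apply/cvgrPdist_le => e e0.
have [d d0 H] := stationary_uniform st c0 e0.
apply/nbhs_ballP; exists d => // t std; exact: H.
Qed.

Lemma antiderivative_lipschitz g G (B : R) : antiderivative g G ->
  (forall s, `|g s| <= B) -> forall a b, `|G b - G a| <= B * `|b - a|.
Proof.
move=> [_ gG] gB.
suff w a b : a <= b -> `|G b - G a| <= B * `|b - a|.
  move=> a b; have [/w//|/ltW/w] := leP a b.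
  by rewrite distrC [`|a - b|]distrC.
move=> ab; have := gG a b B 0 ab (le_trans (normr_ge0 _) (gB 0)).
rewrite scaler0 subr0 => h; apply: le_trans (h _) _ => [t _|].
  by rewrite subr0.
by rewrite mulrC ger0_norm// subr_ge0.
Qed.

(** On each step [G] differs from its affine approximation with slope the left value of [g] by at
    most [h * e / (a + 1)]; the errors add up to [a * e / (a + 1) <= e]. *)
Lemma riemann_sum_cvg g G (a : R) : stationary g -> {for 0, continuous g} ->
  antiderivative g G -> 0 <= a -> forall s,
  \sum_(0 <= j < n.+1) (a / n.+1%:R) *: g (s + j%:R * (a / n.+1%:R)) @[n --> \oo] -->
  G (s + a) - G s.
Proof.
move=> st c0 [_ gG] a0 s; apply/cvgrPdist_le => e e0.
have e1 : 0 < e / (a + 1) by rewrite divr_gt0// ltr_wpDl.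
have [d d0 H] := stationary_uniform st c0 e1.
near=> n; set h := a / n.+1%:R.
have h0 : 0 <= h by rewrite /h divr_ge0.
have hd : h < d.
  rewrite /h ltr_pdivrMr ?ltr0Sn// mulrC -ltr_pdivrMr//.
  apply: lt_le_trans (truncnS_gt _) _; rewrite ler_nat.
  by near: n; exists (Num.truncn (a / d)) => // m /=; rewrite ltnS.
have -> : G (s + a) - G s =
    \sum_(0 <= j < n.+1) (G (s + j.+1%:R * h) - G (s + j%:R * h)).
  rewrite (telescope_sumr (fun j => G (s + j%:R * h)))// mul0r addr0.
  by rewrite /h mulrCA divff ?mulr1// pnatr_eq0.
rewrite -sumrB; apply: le_trans (ler_norm_sum _ _ _) _.
apply: le_trans (_ : \sum_(0 <= j < n.+1) h * (e / (a + 1)) <= _).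
  apply: ler_sum => j _.
  have e2 : (s + j.+1%:R * h) - (s + j%:R * h) = h by rewrite -natr1; ring.
  have := gG (s + j%:R * h) (s + j.+1%:R * h) (e / (a + 1)) (g (s + j%:R * h)).
  rewrite e2; apply; last 1 first.
  - move=> t /andP[t1 t2]; apply: H; rewrite ger0_norm ?subr_ge0//.
    apply: le_lt_trans hd; rewrite lerBlDl; apply: le_trans t2 _.
    by rewrite -natr1 mulrDl mul1r addrA.
  - by rewrite -subr_ge0 e2.
  - exact: ltW.
rewrite sumr_const_nat subn0 -[_ *+ _]mulr_natr mulrAC /h divfK ?pnatr_eq0//.
rewrite mulrCA ger_pMr// ler_pdivrMr ?ltr_wpDl// mul1r.
by rewrite lerDl.
Unshelve. all: by end_near. Qed.

(** An increment of [G] is a limit of Riemann sums, which are combinations of translates of [g] with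
    coefficients independent of [s]; norm invariance passes to the limit. *)
Lemma stationary_increment g G (a : R) : stationary g -> {for 0, continuous g} ->
  antiderivative g G -> 0 <= a -> stationary (fun s => G (s + a) - G s).
Proof.
move=> st c0 gG a0 l s.
pose rs n := [seq (i.1 * (a / n.+1%:R), i.2 + j%:R * (a / n.+1%:R)) |
  i <- l, j <- iota 0 n.+1].
have cv t : combo g (rs n) t @[n --> \oo] --> combo (fun s => G (s + a) - G s) l t.
  have -> : (fun n => combo g (rs n) t) =
      (fun n => \sum_(i <- l) i.1 *: (\sum_(0 <= j < n.+1)
         (a / n.+1%:R) *: g (t + i.2 + j%:R * (a / n.+1%:R)))).
    apply/funext => n; rewrite /combo /rs big_allpairs_dep/=.
    apply: eq_bigr => i _; rewrite scaler_sumr /index_iota subn0.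
    by apply: eq_bigr => j _; rewrite scalerA addrA.
  rewrite /combo; apply: cvg_big => [|i _]; first exact: add_continuous.
  by apply: cvgZl_tmp; exact: riemann_sum_cvg.
have cvn t : `|combo g (rs n) t| @[n --> \oo] --> `|combo (fun s => G (s + a) - G s) l t|.
  by apply: cvg_norm; exact: cv.
have cvs := cvn s; rewrite (_ : (fun n => `|combo g (rs n) s|) =
    (fun n => `|combo g (rs n) 0|)) in cvs; last by apply/funext => n; exact: st.
by rewrite -(cvg_lim _ cvs)// -(cvg_lim _ (cvn 0)).
Qed.

Theorem stationary_cst g : r < 2 -> stationary g -> {for 0, continuous g} ->
  forall s t, g s = g t.
Proof.
move=> r2 st c0.
pose B := `|g 0|.
have gB s : `|g s| <= B by rewrite (stationary_norm st).
have [G gG] := bounded_antiderivative (stationary_continuous st c0) gB.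
(* If the second differences of [G] vanish for all steps, differentiation in the step makes [g]
   constant. *)
suff second (a s : R) : 0 < a -> G (s + a + a) - G (s + a) - (G (s + a) - G s) = 0.
  suff main s t : s < t -> g s = g t.
    by move=> s t; case: (ltgtP s t) => [/main|/main/esym|->].
  move=> st'; apply: lp_seqP => k; have [dG _] := gG.
  have [b bE] : exists b, s = t - b by exists (t - s); rewrite subKr.
  subst s; have b0 : 0 < b by rewrite ltrBlDr ltrDl in st'.
  (* One step [b] from here leads to [t - b], two steps lead to [t]. The derivative at [b] of the
     second difference [F] is twice the difference of the values of [g] there. *)
  pose s := t - b - b.
  pose F (x : R) := lp_seq (G (x + x + s)) k - 2 * lp_seq (G (x + s)) k + lp_seq (G s) k.
  have dF : is_derive b (1 : R) F (2 * lp_seq (g (b + b + s)) k - 2 * lp_seq (g (b + s)) k).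
    have d1 : is_derive b (1 : R) (fun x => lp_seq (G (x + x + s)) k)
        (2 * lp_seq (g (b + b + s)) k).
      have id2 : is_derive b (1 : R) (fun x : R => x + x + s) 2.
        by apply: is_derive_eq; rewrite addr0.
      have := @is_derive1_comp _ (fun x => lp_seq (G x) k) (fun x => x + x + s) b _ _
        (dG k (b + b + s)) id2.
      by rewrite mulrC.
    have d2 := @is_deriveZ _ _ _ _ (2 : R) _ _ _ (is_derive_shift (dG k (b + s))).
    have d3 := @is_deriveD _ _ _ _ (cst (lp_seq (G s) k)) _ _ _ _
      (@is_deriveB _ _ _ _ _ _ _ _ _ d1 d2) (is_derive_cst _ _ _).
    by apply: (is_derive_eq d3); rewrite addr0.
  have dF0 : is_derive b (1 : R) F 0.
    apply: (@near_eq_is_derive _ _ _ (cst 0)).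
    near=> x; have x0 : 0 < x by near: x; exact: lt_nbhsr.
    have := congr1 (fun y => lp_seq y k) (second x s x0).
    rewrite !lp_seqB lp_seq0 => h; rewrite /= -h /F ![_ + s]addrC addrA.
    by ring.
  have [_ e1] := dF; have [_ e2] := dF0.
  move: e1; rewrite e2 /s.
  have -> : b + b + (t - b - b) = t by ring.
  have -> : b + (t - b - b) = t - b by ring.
  move/esym/eqP; rewrite subr_eq0 => /eqP h.
  by apply: (@mulfI _ (2 : R)) => //; rewrite h.
move=> a0.
(* The first smoothing, Lipschitz with constant [2 B]. The second, [g2], meets the [O(h ^ 2)]
   condition of the smooth case. *)
pose g1 s := G (s + a) - G s.
have g1E s' : G (s' + a) - G s' = g1 s' by [].
have st1 : stationary g1 by apply: stationary_increment (ltW a0).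
have lip1 x y : `|g1 x - g1 y| <= 2 * B * `|x - y|.
  have -> : g1 x - g1 y = (G (x + a) - G (y + a)) - (G x - G y).
    by rewrite /g1 !opprD !opprK addrACA.
  apply: le_trans (ler_normB _ _) _.
  have -> : 2 * B * `|x - y| = B * `|x + a - (y + a)| + B * `|x - y|.
    by rewrite (_ : x + a - (y + a) = x - y); ring.
  by rewrite lerD// (antiderivative_lipschitz gG).
have B0 : 0 <= B by exact: normr_ge0.
have c1 : {for 0, continuous g1}.
  apply/cvgrPdist_le => e e0.
  have d0 : 0 < e / (2 * B + 1) by rewrite divr_gt0// ltr_wpDl// mulr_ge0.
  apply/nbhs_ballP; exists (e / (2 * B + 1)) => // x /ltW h.
  apply: le_trans (lip1 _ _) _.
  apply: le_trans (_ : (2 * B + 1) * (e / (2 * B + 1)) <= _).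
    by apply: ler_pM; rewrite ?mulr_ge0// lerDl.
  by rewrite mulrC divfK// gt_eqF// ltr_wpDl// mulr_ge0.
have g1B t : `|g1 t| <= `|g1 0| by rewrite (stationary_norm st1).
have [G1 gG1] := bounded_antiderivative (stationary_continuous st1 c1) g1B.
pose g2 t := G1 (t + a) - G1 t.
have st2 : stationary g2 by exact: (stationary_increment st1 c1 gG1 (ltW a0)).
have [dG1 G1E] := gG1.
pose dg k (t : R) : R := lp_seq (g1 (t + a)) k - lp_seq (g1 t) k.
have dg2 k (t : R) : is_derive t (1 : R) (fun x => lp_seq (g2 x) k) (dg k t).
  by have := @is_deriveB _ _ _ _ _ _ _ _ _ (is_derive_shift (dG1 k (t + a))) (dG1 k t).
have C0 : 0 <= 2 * B by rewrite mulr_ge0.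
have half t h : 0 <= h -> `|G1 (t + h) + G1 (t - h) - 2 *: G1 t| <= 4 * B * h ^+ 2.
  move=> h0.
  have -> : G1 (t + h) + G1 (t - h) - 2 *: G1 t =
      (G1 (t + h) - G1 t - h *: g1 t) - (G1 t - G1 (t - h) - h *: g1 t).
    apply: lp_seqP => k.
    by rewrite !(lp_seqD, lp_seqN, lp_seqZ); ring.
  (* Mean value inequality with [w = g1 t], from which [g1] deviates by at most [2 B h] within
     distance [h] of [t]. *)
  have p1 : `|G1 (t + h) - G1 t - h *: g1 t| <= h * (2 * B * h).
    have := G1E t (t + h) (2 * B * h) (g1 t).
    rewrite (_ : t + h - t = h); last by ring.
    apply; rewrite ?lerDl ?mulr_ge0// => x /andP[x1 x2].
    apply: le_trans (lip1 _ _) _; rewrite ler_wpM2l// ger0_norm ?subr_ge0//.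
    by rewrite lerBlDl.
  have p2 : `|G1 t - G1 (t - h) - h *: g1 t| <= h * (2 * B * h).
    have := G1E (t - h) t (2 * B * h) (g1 t).
    rewrite (_ : t - (t - h) = h); last by ring.
    apply; rewrite ?gerBl ?mulr_ge0// => x /andP[x1 x2].
    apply: le_trans (lip1 _ _) _; rewrite ler_wpM2l// distrC ger0_norm ?subr_ge0//.
    by rewrite lerBlDl -lerBlDr.
  apply: le_trans (ler_normB _ _) _; apply: le_trans (lerD p1 p2) _.
  by rewrite le_eqVlt; apply/orP; left; apply/eqP; ring.
have smooth t h : `|g2 (t + h) + g2 (t - h) - 2 *: g2 t| <= 8 * B * h ^+ 2.
  wlog h0 : h / 0 <= h.
    move=> w; have [/w//|/ltW h0] := leP 0 h.
    have := w (- h); rewrite oppr_ge0 opprK sqrrN [g2 (t - h) + _]addrC; exact.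
  have -> : g2 (t + h) + g2 (t - h) - 2 *: g2 t =
      (G1 (t + a + h) + G1 (t + a - h) - 2 *: G1 (t + a)) - (G1 (t + h) + G1 (t - h) - 2 *: G1 t).
    rewrite /g2 ![t + a + _]addrAC; apply: lp_seqP => k.
    by rewrite !(lp_seqD, lp_seqN, lp_seqZ); ring.
  apply: le_trans (ler_normB _ _) _; apply: le_trans (lerD (half _ _ h0) (half _ _ h0)) _.
  by rewrite le_eqVlt; apply/orP; left; apply/eqP; ring.
(* As [g2] is constant, its derivative [g1 (t + a) - g1 t] vanishes: this is the second difference
   of [G]. *)
have cst2 := stationary_smooth_cst r2 st2 smooth dg2.
apply: lp_seqP => k; rewrite lp_seqB lp_seq0 !g1E -/(dg k s).
have [_ <-] := dg2 k s.
have -> : (fun x => lp_seq (g2 x) k) = cst (lp_seq (g2 0) k).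
  by apply/funext => x; rewrite (cst2 x 0).
exact: derive_cst.
Unshelve. all: by end_near. Qed.

End rigidity.

(** * Recurrent orbits *)

Section weak_contractivity.
Context (R : realType) (X : completeNormedModType R).
Implicit Types (f : {scalar X}) (T : R -> {linear X -> X}).

Lemma lipschitz_linear_continuous (Y : normedModType R) (f : X -> Y) (C : R) :
  (forall x y, f (x - y) = f x - f y) -> (forall x, `|f x| <= C * `|x|) -> continuous f.
Proof.
move=> fB fC x; apply/cvgrPdist_le => e e0.
have C0 : 0 < `|C| + 1 by rewrite ltr_wpDl.
apply/nbhs_ballP; exists (e / (`|C| + 1)); first by rewrite /= divr_gt0.
move=> y; rewrite -ball_normE/= => /ltW h; rewrite -fB; apply: le_trans (fC _) _.
apply: le_trans (_ : (`|C| + 1) * (e / (`|C| + 1)) <= _).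
  apply: le_trans (ler_wpM2r (normr_ge0 _) (ler_norm C)) _.
  by apply: ler_pM => //; rewrite lerDl.
by rewrite mulrC divfK// gt_eqF.
Qed.

Definition scaled_functional (a : R) f (x : X) : R := a * f x.

Let scaled_functional_is_linear a f : linear_for *%R (scaled_functional a f).
Proof. by move=> b x y; rewrite /scaled_functional linearP mulrDr mulrCA. Qed.

HB.instance Definition _ a f :=
  GRing.isLinear.Build R X R *%R (scaled_functional a f) (scaled_functional_is_linear a f).

(** The limsup condition after rescaling [x] and [f] to norm 1, in a form that accepts any upper
    bound [C] for the norm of [f]. *)
Lemma weak_bound T f (C : R) x : weakly_asymptotically_contractive T ->
  0 <= C -> (forall w, `|f w| <= C * `|w|) ->
  forall d, 0 < d -> \forall t \near +oo_R, `|f (T t x)| <= C * `|x| + d.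
Proof.
move=> hw C0 fC d d0.
have [->|x0] := eqVneq x 0.
  by apply: nearW => t; rewrite !linear0 !normr0 mulr0 add0r ltW.
pose S := [set `|f x| | x in [set x : X | `|x| <= 1]].
have supS : has_sup S.
  split; first by exists `|f 0|; exists 0 => //=; rewrite normr0.
  exists C => _ [y /= y1 <-]; apply: le_trans (fC y) _.
  by rewrite ler_piMr.
have [f0|/existsNP[w /eqP fw]] := pselect (forall w, f w = 0).
  by apply: nearW => t; rewrite f0 normr0 addr_ge0 ?mulr_ge0// ltW.
have w0 : 0 < `|w|.
  by rewrite normr_gt0; apply: contra fw => /eqP->; rewrite linear0.
pose D := dual_norm f.
have D0 : 0 < D.
  apply: lt_le_trans (_ : `|f (`|w|^-1 *: w)| <= _).
    by rewrite linearZ/= normrM mulr_gt0 ?normr_gt0// invr_neq0// gt_eqF.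
  apply: (sup_upper_bound supS); exists (`|w|^-1 *: w) => //=.
  by rewrite normrZ normfV normr_id mulVf// gt_eqF.
have DC : D <= C.
  apply: ge_sup; first by case: supS.
  by move=> _ [y /= y1 <-]; apply: le_trans (fC y) _; rewrite ler_piMr.
pose g : {scalar X} := scaled_functional D^-1 f.
have gE y : g y = D^-1 * f y by [].
have gcont : continuous (g : X -> R).
  apply: (@lipschitz_linear_continuous _ _ (D^-1 * C)) => [y z|y].
    by rewrite linearB.
  by rewrite gE normrM -mulrA gtr0_norm ?invr_gt0// ler_wpM2l ?invr_ge0 ?(ltW D0).
have gnorm : dual_norm g = 1.
  rewrite /dual_norm.
  have -> : [set `|g x| | x in [set x : X | `|x| <= 1]] = [set D^-1 * y | y in S].
    apply/seteqP; split => [_ [y y1 <-]|_ [_ [y y1 <-] <-]].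
      by exists `|f y|; [exists y|rewrite gE normrM gtr0_norm ?invr_gt0].
    by exists y => //; rewrite gE normrM gtr0_norm ?invr_gt0.
  have [S1 _] := supS.
  apply/eqP; rewrite eq_le; apply/andP; split.
    apply: ge_sup; first by case: S1 => y Sy; exists (D^-1 * y), y.
    move=> _ [y Sy <-]; rewrite ler_pdivrMl// mulr1.
    exact: sup_upper_bound.
  rewrite -(ler_pM2l D0) mulr1; apply: ge_sup => // y Sy.
  rewrite -ler_pdivrMl//; apply: sup_upper_bound; last by exists y.
  split; first by exists (D^-1 * y), y.
  exists (D^-1 * D) => _ [z Sz <-]; rewrite ler_wpM2l ?invr_ge0 ?(ltW D0)//.
  exact: sup_upper_bound.
have x1 : `| `|x|^-1 *: x| = 1.
  by rewrite normrZ normfV normr_id mulVf// normr_eq0.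
have nx : 0 < `|x| by rewrite normr_gt0.
have := hw (`|x|^-1 *: x) g x1 gcont gnorm.
(* Undoing both normalisations multiplies the error by [D * |x|]. *)
pose e := d / (D * `|x|).
have e0 : 0 < e by rewrite divr_gt0// mulr_gt0.
rewrite limf_esupE => /le_lt_trans/(_ (_ : 1 < (1 + e)%:E)%E).
rewrite lte_fin ltrDl => /(_ e0)/ereal_inf_lt[_ [V FV <-] sV].
apply: filterS FV => t Vt.
have : (`|g (T t (`|x|^-1 *: x))|%:E < (1 + e)%:E)%E.
  by apply: le_lt_trans sV; apply: ereal_sup_ubound; exists t.
rewrite lte_fin => /ltW; rewrite gE !linearZ/= !normrM !normfV normr_id (gtr0_norm D0).
rewrite ler_pdivrMl// ler_pdivrMl// => /le_trans; apply.
rewrite mulrDr mulrDr mulr1 mulrCA mulrA [in X in _ + X]mulrC lerD//.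
  by rewrite mulrC ler_wpM2r// ltW.
by rewrite /e divfK// mulf_neq0 ?gt_eqF.
Qed.

End weak_contractivity.

Section contraction_of_limits.
Context (R : realType) (p : R) (p1 : 1 <= p).
Local Notation E := (lp p1).
Variable T : R -> {linear E -> E}.
Hypothesis hw : weakly_asymptotically_contractive T.

Lemma dual_map_continuous (u : E) : continuous (dual_map u).
Proof.
apply: (@lipschitz_linear_continuous _ _ _ _ (`|u| `^ (p - 1))) => [x y|x].
  by rewrite linearB.
exact: dual_map_le.
Qed.

(** Test against the norming functional of the limit: [|y| ^ p] is the limit of
    [dual_map y (T (theta j) x)], at most [|y| ^ (p - 1) * |x|]. The filter is general in order to
    serve both sequences and ultrafilters. *)
Lemma orbit_limit_contraction (J : Type) (F : set_system J) {FF : ProperFilter F}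
    (theta : J -> R) (x y : E) :
  theta j @[j --> F] --> +oo_R -> T (theta j) x @[j --> F] --> y -> `|y| <= `|x|.
Proof.
move=> thoo Ty.
have [y0|y0] := eqVneq y 0; first by rewrite y0 normr0.
have ny : 0 < `|y| by rewrite normr_gt0.
have p0 : 0 < p by exact: lt_le_trans p1.
have cf : dual_map y (T (theta j) x) @[j --> F] --> `|y| `^ p.
  rewrite -dual_map_self; apply: (@cvg_comp _ _ _ _ (dual_map y) _ _ _ Ty).
  exact: dual_map_continuous.
rewrite -(ler_pM2l (powR_gt0 (p - 1) ny)) mulrC mulr_powRB1//.
apply/ler_addgt0Pr => d d0.
apply: (cvgr_to_le cf).
have h : \forall j \near F,
    `|dual_map y (T (theta j) x)| <= `|y| `^ (p - 1) * `|x| + d.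
  apply: (thoo _ (@weak_bound _ _ T (dual_map y) _ x hw _ _ d d0)).
    exact: powR_ge0.
  exact: dual_map_le.
by near=> j; apply: le_trans (ler_norm _) _; near: j.
Unshelve. all: by end_near. Qed.

End contraction_of_limits.

(** * The Mazur map *)

Section power_map.
Context (R : realType).

(** For equal signs this is the tangent inequality at the larger modulus; for opposite signs
    [|a - b| = |a| + |b|] and the triangle inequality suffices. *)
Lemma sgpow_lipschitz (m a b : R) : 1 <= m ->
  `|sgpow m a - sgpow m b| <= m * ((`|a| + `|b|) `^ (m - 1) * `|a - b|).
Proof.
move=> m1; have m0 : 0 < m by exact: lt_le_trans m1.
have pos x y : 0 <= y -> y <= x ->
    `|sgpow m x - sgpow m y| <= m * ((`|x| + `|y|) `^ (m - 1) * `|x - y|).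
  move=> y0 yx; have x0 : 0 <= x by exact: le_trans yx.
  have sE z : 0 <= z -> sgpow m z = z `^ m.
    rewrite le_eqVlt /sgpow => /predU1P[<-|z0].
      by rewrite sgr0 mul0r powR0 ?gt_eqF.
    by rewrite gtr0_sg// mul1r gtr0_norm.
  rewrite !sE// !ger0_norm ?subr_ge0//; last exact: ge0_ler_powR (ltW m0) _ _ y0 x0 yx.
  have := young m1 x0 y0; have := mulr_powRB1 x0 m0.
  have : x `^ (m - 1) <= (x + y) `^ (m - 1).
    by apply: ge0_ler_powR; rewrite ?nnegrE ?subr_ge0 ?addr_ge0 ?lerDl.
  move=> h xm ym.
  apply: le_trans (_ : m * (x `^ (m - 1) * (x - y)) <= _).
    by nra.
  by rewrite ler_wpM2l ?(ltW m0)// ler_wpM2r// subr_ge0.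
have opp x y : 0 <= x -> y <= 0 ->
    `|sgpow m x - sgpow m y| <= m * ((`|x| + `|y|) `^ (m - 1) * `|x - y|).
  move=> x0 y0; have xy : `|x - y| = `|x| + `|y|.
    by rewrite ger0_norm ?subr_ge0 ?(le_trans y0)// ger0_norm// ler0_norm.
  have n0 : 0 <= `|x| + `|y| by rewrite addr_ge0.
  rewrite xy mulrC [_ `^ _ * _]mulrC mulr_powRB1// -[leLHS]mulr1.
  apply: ler_pM => //; rewrite ?normr_ge0//.
  apply: le_trans (ler_normB _ _) _; rewrite !sgpow_norm//.
  rewrite -(mulr_powRB1 n0 m0) mulrDl.
  by apply: lerD; (rewrite -{1}mulr_powRB1//; apply: ler_wpM2l => //;
    apply: ge0_ler_powR; rewrite ?nnegrE ?subr_ge0 ?lerDl ?lerDr).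
have sym x y : `|sgpow m x - sgpow m y| <= m * ((`|x| + `|y|) `^ (m - 1) * `|x - y|) ->
    `|sgpow m y - sgpow m x| <= m * ((`|y| + `|x|) `^ (m - 1) * `|y - x|).
  by rewrite distrC [`|x| + _]addrC [`|x - y|]distrC.
have neg x y : `|sgpow m (- x) - sgpow m (- y)| <=
      m * ((`|- x| + `|- y|) `^ (m - 1) * `|- x - - y|) ->
    `|sgpow m x - sgpow m y| <= m * ((`|x| + `|y|) `^ (m - 1) * `|x - y|).
  by rewrite !sgpowN !normrN -!opprD !normrN.
have [a0|/ltW a0] := leP 0 a; have [b0|/ltW b0] := leP 0 b.
- by have [/pos|/ltW/pos] := leP b a; [exact|move=> /(_ a0)/sym].
- exact: opp.
- exact/sym/opp.
- apply: neg; have [h|/ltW h] := leP a b.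
    by apply: pos; rewrite ?oppr_ge0 ?lerN2.
  by apply: sym; apply: pos; rewrite ?oppr_ge0 ?lerN2.
Qed.

Context (p q m : R) (p1 : 1 <= p) (q1 : 1 <= q).
Hypotheses (m0 : 0 < m) (mq : m * q = p).

Let p0 : 0 < p. Proof. exact: lt_le_trans p1. Qed.
Let q0 : 0 < q. Proof. exact: lt_le_trans q1. Qed.

Lemma lp_power_ex (u : lp p1) :
  exists2 w : lp q1, lp_seq w = (fun k => sgpow m (lp_seq u k)) & `|w| = `|u| `^ m.
Proof.
have E k : `|sgpow m (lp_seq u k)| `^ q = `|lp_seq u k| `^ p.
  by rewrite sgpow_norm// -powRrM mq.
have [||w wE wle] := @lp_bounded_sum _ _ q1 (fun k => sgpow m (lp_seq u k)) (`|u| `^ m).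
- exact: powR_ge0.
- move=> n; under eq_bigr do rewrite E.
  by rewrite -powRrM mq; exact: lp_psum_le.
exists w => //; apply: (@powR_injective _ q); rewrite ?nnegrE ?powR_ge0//.
rewrite -powRrM mq.
have := @lp_psum_cvg _ _ q1 w; rewrite wE.
under [fun k => `|sgpow _ _| `^ _]eq_fun do rewrite E.
by move=> /cvg_lim <- //; apply/cvg_lim => //; exact: lp_psum_cvg.
Qed.

(** The Mazur map from [l^p] to [l^q], [p = m * q]. *)
Definition lp_power (u : lp p1) : lp q1 := sval (cid2 (lp_power_ex u)).

Lemma lp_powerE u k : lp_seq (lp_power u) k = sgpow m (lp_seq u k).
Proof. by rewrite /lp_power; case: cid2 => w /= -> _. Qed.

Lemma lp_power_norm u : `|lp_power u| = `|u| `^ m.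
Proof. by rewrite /lp_power; case: cid2 => w /=. Qed.

(** The scalar estimate raised to the power [q] in each coordinate, followed by the Hoelder
    inequality with exponent [m]. *)
Lemma lp_power_lipschitz (u v : lp p1) : 1 <= m ->
  `|lp_power u - lp_power v| <= m * ((`|u| + `|v|) `^ (m - 1) * `|u - v|).
Proof.
move=> m1; have uv0 : 0 <= `|u| + `|v| by rewrite addr_ge0.
apply: lp_norm_le; first by rewrite !mulr_ge0 ?powR_ge0 ?(ltW m0).
move=> n.
apply: le_trans (_ : m `^ q * \sum_(0 <= k < n)
    ((`|lp_seq u k| + `|lp_seq v k|) `^ q) `^ (m - 1) * `|lp_seq (u - v) k| `^ q <= _).
  rewrite mulr_sumr; apply: ler_sum => k _.
  rewrite powRAC -!powRM ?powR_ge0 ?mulr_ge0 ?addr_ge0 ?powR_ge0 ?(ltW m0)//.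
  apply: ge0_ler_powR; rewrite ?nnegrE ?mulr_ge0 ?powR_ge0 ?addr_ge0 ?(ltW q0) ?(ltW m0)//.
  by rewrite lp_seqB !lp_powerE; exact: sgpow_lipschitz.
rewrite powRM ?mulr_ge0 ?powR_ge0 ?(ltW m0)// ler_wpM2l ?powR_ge0//.
rewrite powRM ?powR_ge0// powRAC.
have mqE x : (x `^ q) `^ m = x `^ p by rewrite -powRrM mulrC mq.
apply: holder_sum => //; do ?[by move=> *; exact: powR_ge0].
- under eq_bigr do rewrite mqE; rewrite mqE.
  (* With the coordinatewise moduli, Minkowski's inequality is the triangle inequality of [l^p]. *)
  have [u' u'E u'n] := lp_abs u; have [v' v'E v'n] := lp_abs v.
  apply: le_trans (_ : `|u' + v'| `^ p <= _); last first.
    apply: ge0_ler_powR; rewrite ?nnegrE ?(ltW p0)//.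
    by rewrite -u'n -v'n ler_normD.
  apply: le_trans (lp_psum_le (u' + v') n).
  apply: ler_sum => k _; rewrite lp_seqD u'E v'E.
  by rewrite [X in _ <= X `^ _]ger0_norm// addr_ge0.
- by under eq_bigr do rewrite mqE; rewrite mqE; exact: lp_psum_le.
Qed.

End power_map.

(** * The pairing of [l^p] with [l^q] for conjugate exponents *)

Section duality.
Context (R : realType) (p q : R) (p1 : 1 <= p) (q1 : 1 <= q).
Hypothesis pq : (p - 1) * q = p.

Let p0 : 0 < p. Proof. exact: lt_le_trans p1. Qed.

Lemma conjugate_gt1 : 0 < p - 1.
Proof.
rewrite lt_neqAle subr_ge0 p1 andbT eq_sym.
by apply/eqP => h; move: pq; rewrite h mul0r => h'; move: p0; rewrite -h' ltxx.
Qed.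

Let qE : (q - 1) * (p - 1) = 1.
Proof. by have := pq; nra. Qed.

Lemma conjugate_gt1' : 0 < q - 1.
Proof.
by rewrite -(pmulr_lgt0 _ conjugate_gt1) qE.
Qed.

Lemma conjugateC : (q - 1) * p = q.
Proof. by have := pq; nra. Qed.

Definition dualize : lp p1 -> lp q1 := @lp_power R p q (p - 1) p1 q1 conjugate_gt1 pq.
Definition predual : lp q1 -> lp p1 := @lp_power R q p (q - 1) q1 p1 conjugate_gt1' conjugateC.

(** Written through [dual_map], so that its linearity and [weak_bound] apply to [pairing f] at once;
    [pairingE] recovers the coordinate pairing. *)
Definition pairing (f : lp q1) (w : lp p1) : R := dual_map (predual f) w.

Lemma pairingE f w : pairing f w = dot (lp_seq f) (lp_seq w).
Proof.
rewrite /pairing /dual_map; congr dot; apply/funext => k.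
by rewrite lp_powerE sgpow_comp ?conjugate_gt1'// qE sgpow1.
Qed.

Lemma pairing_bound (f : lp q1) (w : lp p1) : dot_bound (lp_seq f) (lp_seq w) (`|f| * `|w|).
Proof.
have := dual_map_bound (predual f) w; rewrite lp_power_norm -powRrM qE powRr1//.
by move=> h n; apply: le_trans (h n); apply: ler_sum => k _;
  rewrite lp_powerE sgpow_comp ?conjugate_gt1'// qE sgpow1.
Qed.

Lemma pairing_le f w : `|pairing f w| <= `|f| * `|w|.
Proof. by rewrite pairingE; exact/dot_le/pairing_bound. Qed.

Lemma pairing_dualize u w : pairing (dualize u) w = dual_map u w.
Proof. by rewrite pairingE /dual_map; congr dot; apply/funext => k; rewrite lp_powerE. Qed.

Lemma pairing_predual f : pairing f (predual f) = `|f| * `|predual f|.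
Proof.
rewrite /pairing dual_map_self lp_power_norm -powRrM conjugateC.
by rewrite mulr_powRB1// (lt_le_trans _ q1).
Qed.

Lemma pairingDl f g w : pairing (f + g) w = pairing f w + pairing g w.
Proof.
rewrite !pairingE dotC (_ : lp_seq (f + g) = fun k => lp_seq f k + lp_seq g k)//.
have b (h : lp q1) : dot_bound (lp_seq w) (lp_seq h) (`|h| * `|w|).
  by move=> n; under eq_bigr do rewrite mulrC; exact: (pairing_bound h w n).
by rewrite (dotDr (b f) (b g)) dotC [in X in _ + X]dotC.
Qed.

Lemma pairingZl a f w : pairing (a *: f) w = a * pairing f w.
Proof.
rewrite !pairingE dotC (_ : lp_seq (a *: f) = fun k => a * lp_seq f k)//.
have b : dot_bound (lp_seq w) (lp_seq f) (`|f| * `|w|).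
  by move=> n; under eq_bigr do rewrite mulrC; exact: (pairing_bound f w n).
by rewrite (dotZr _ b) dotC.
Qed.

Lemma pairingBl f g w : pairing (f - g) w = pairing f w - pairing g w.
Proof. by rewrite pairingDl -scaleN1r pairingZl mulN1r. Qed.

End duality.

Section complete_orbits.
Context (R : realType) (p : R) (p1 : 1 <= p).
Local Notation E := (lp p1).
Variable T : R -> {linear E -> E}.
Hypothesis hT : C0_semigroup T.
Hypothesis hw : weakly_asymptotically_contractive T.
Variable tau : nat -> R.
Hypothesis tauoo : tau n @[n --> \oo] --> +oo_R.
Implicit Types u : R -> E.

Definition complete_orbit u := forall r s, 0 <= r -> T r (u s) = u (s + r).
(** One sequence [tau] serves all orbits and all [s], so that recurrence is inherited by
    combinations of translates. *)
Definition recurrent u := forall s, u (s + tau n) @[n --> \oo] --> u s.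

Let tau_shift (c : R) : tau n + c @[n --> \oo] --> +oo_R.
Proof.
by apply/cvgryPge => A; move/cvgryPge : tauoo => /(_ (A - c)); apply: filterS => n;
  rewrite lerBlDr.
Qed.

(** [u t] is the limit of [T (tau n + (t - s)) (u s)], hence [|u t| <= |u s|], and [s], [t] are
    arbitrary. *)
Lemma orbit_norm u : complete_orbit u -> recurrent u -> forall s t, `|u s| = `|u t|.
Proof.
move=> ou ru; suff le s t : `|u t| <= `|u s|.
  by move=> s t; apply/eqP; rewrite eq_le !le.
apply: (orbit_limit_contraction hw (tau_shift (t - s))).
apply: cvg_trans (ru t); apply: near_eq_cvg.
have /cvgryPge/(_ 0) := @tau_shift (t - s); apply: filterS => n h.
by rewrite ou//; congr u; ring.
Qed.

(** A combination of translates is again a recurrent complete orbit, so its norm is constant. *)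
Lemma orbit_stationary u : complete_orbit u -> recurrent u -> stationary u.
Proof.
move=> ou ru l s; apply: orbit_norm.
  move=> r s' r0; rewrite /combo linear_sum; apply: eq_bigr => i _.
  by rewrite linearZ/= ou// addrAC.
move=> s'; rewrite /combo; apply: cvg_big => [|i _]; first exact: add_continuous.
by apply: cvgZl_tmp; under eq_fun do rewrite addrAC; exact: ru.
Qed.

(** * The dual orbit for [p > 2] *)

Section superquadratic.
Context (q : R) (q1 : 1 <= q) (p2 : 2 < p) (pq : (p - 1) * q = p).

Let m1 : 1 <= p - 1. Proof. by rewrite lerBrDr ltW. Qed.
Let m0 : 0 < p - 1. Proof. exact: lt_le_trans m1. Qed.

Local Notation dual := (dualize q1 pq : lp p1 -> lp q1).

(** Differentiability of the norm at [y] in the direction [w], multiplied by [|y| ^ (p - 1)]; it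
    comes from the Lipschitz estimate for the duality map. *)
Lemma dual_map_gradient (y w : E) (d : R) : 0 < d -> exists2 e, 0 < e &
  `|y| `^ (p - 1) * `|y + e *: w| - `|y| `^ p <= e * (dual_map y w + d).
Proof.
(* [e * K] bounds the change of [dual_map _ w] between [y] and [y + e w] for [e <= 1]; [e] is then
   chosen with [e * K <= d]. *)
move=> d0; pose K := (p - 1) * (2 * `|y| + `|w|) `^ (p - 1 - 1) * `|w| ^+ 2.
have K0 : 0 <= K by rewrite !mulr_ge0 ?powR_ge0 ?(ltW m0).
pose e := Num.min 1 (d / (K + 1)).
have e0 : 0 < e by rewrite lt_min ltr01 divr_gt0// ltr_wpDl.
have e1 : e <= 1 by rewrite ge_min lexx.
have eK : e * K <= d.
  apply: le_trans (_ : d / (K + 1) * (K + 1) <= _).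
    by apply: ler_pM; rewrite ?(ltW e0) ?lerDl// ge_min lexx orbT.
  by rewrite divfK// gt_eqF// ltr_wpDl.
exists e => //; set z := y + e *: w.
have p0 : 0 < p by exact: lt_le_trans p1.
have zy : z - y = e *: w by rewrite /z addrAC subrr add0r.
have nzy : `|z - y| = e * `|w| by rewrite zy normrZ gtr0_norm.
have dz : e * dual_map z w <= e * (dual_map y w + d).
  rewrite ler_pM2l// -lerBlDl.
  rewrite -!(pairing_dualize q1 pq) -pairingBl.
  apply: le_trans (ler_norm _) _; apply: le_trans (pairing_le _ _ _) _.
  apply: le_trans eK.
  apply: le_trans (ler_wpM2r (normr_ge0 _) (lp_power_lipschitz _ _ _ z y m1)) _.
  rewrite nzy /K.
  have : (`|z| + `|y|) `^ (p - 1 - 1) <= (2 * `|y| + `|w|) `^ (p - 1 - 1).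
    apply: ge0_ler_powR; rewrite ?nnegrE ?subr_ge0 ?addr_ge0 ?mulr_ge0//.
    have : `|z| <= `|y| + `|w|.
      apply: le_trans (ler_normD _ _) _; rewrite lerD2l normrZ gtr0_norm//.
      by rewrite ler_piMl.
    by move: `|z| `|y| `|w| => *; lra.
  have : 0 <= (p - 1) * (e * `|w| ^+ 2) by rewrite !mulr_ge0 ?(ltW m0) ?(ltW e0).
  by move=> h /(ler_wpM2l h); rewrite !expr2; move: (_ `^ _) (_ `^ _) => a b; nra.
apply: le_trans dz.
(* The right side is at least [|z| ^ (p - 1) * (|z| - |y|)], and this is at least
   [|y| ^ (p - 1) * (|z| - |y|)] by monotonicity. *)
have -> : e * dual_map z w = dual_map z z - dual_map z y.
  by rewrite -linearB zy linearZ.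
rewrite dual_map_self.
have h := le_trans (ler_norm _) (dual_map_le z y).
apply: le_trans (lerB (lexx _) h).
rewrite -!(mulr_powRB1 (normr_ge0 _) p0).
have [yz|zy'] := leP `|y| `|z|.
  have : `|y| `^ (p - 1) <= `|z| `^ (p - 1).
    by apply: ge0_ler_powR; rewrite ?nnegrE ?(ltW m0).
  by move: (_ `^ _) (_ `^ _) yz => a b yz ab; nra.
have : `|z| `^ (p - 1) <= `|y| `^ (p - 1).
  by apply: ge0_ler_powR; rewrite ?nnegrE ?(ltW m0) ?(ltW zy').
by move: (_ `^ _) (_ `^ _) zy' => a b yz ab; nra.
Qed.

(* Smoothness of the norm forces the weak limit points of the norming functionals:
   [f (T t (y + e w)) <= |y + e w| + o(1)] is an equality to first order in [e]. *)
Lemma dual_map_flow_cvg u (s r : R) (w : E) : complete_orbit u -> recurrent u -> 0 <= r ->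
  dual_map (u (s + r)) (T (tau n + r) w) @[n --> \oo] --> dual_map (u s) w.
Proof.
move=> ou ru r0.
(* A bound from above suffices: the one from below is that for [- w]. *)
suff upper (w' : E) (d : R) : 0 < d -> \forall n \near \oo,
    dual_map (u (s + r)) (T (tau n + r) w') <= dual_map (u s) w' + d.
  apply/cvgrPdist_le => d d0; near=> n.
  rewrite ler_norml; apply/andP; split.
    have : dual_map (u (s + r)) (T (tau n + r) w) <= dual_map (u s) w + d.
      by near: n; exact: upper.
    by rewrite lerBrDr [- d + _]addrC lerBlDr.
  have : dual_map (u (s + r)) (T (tau n + r) (- w)) <= dual_map (u s) (- w) + d.
    by near: n; exact: upper.
  have TN : T (tau n + r) (- w) = - T (tau n + r) w by exact: linearN.
  by rewrite TN !dual_mapN lerNl opprD opprK lerBlDr lerBlDl.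
(* One third each for the gradient estimate, the recurrence of [u] and the weak contractivity, the
   last two scaled by [e]. *)
move=> d0; have d20 : 0 < d / 3 by rewrite divr_gt0.
have [e e0 he] := dual_map_gradient (u s) w' d20.
have nE := orbit_norm ou ru.
pose f := dual_map (u (s + r)).
have c1 : f (u (s + r + tau n)) @[n --> \oo] --> `|u s| `^ p.
  rewrite (nE s (s + r)) -dual_map_self.
  apply: (@cvg_comp _ _ _ _ f _ _ _ (ru (s + r))).
  exact: dual_map_continuous.
have ed0 : 0 < e * (d / 3) by rewrite mulr_gt0.
have /(tau_shift r) h2 := @weak_bound _ _ T f _ (u s + e *: w') hw (powR_ge0 _ _)
  (dual_map_le (u (s + r))) _ ed0.
near=> n.
have n1 : `|u s| `^ p - f (u (s + r + tau n)) <= e * (d / 3).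
  apply: le_trans (ler_norm _) _; near: n.
  by move/cvgrPdist_le : c1 => /(_ _ ed0).
have n2 : f (T (tau n + r) (u s + e *: w')) <=
    `|u s| `^ (p - 1) * `|u s + e *: w'| + e * (d / 3).
  by rewrite (nE s (s + r)); apply: le_trans (ler_norm _) _; near: n; exact: h2.
have n3 : 0 <= tau n + r by near: n; have /cvgryPge/(_ 0) := @tau_shift r.
have TE : T (tau n + r) (u s + e *: w') = u (s + r + tau n) + e *: T (tau n + r) w'.
  by rewrite linearD linearZ/= ou//; congr (u _ + _); ring.
move: n2; rewrite TE /f dual_mapD dual_mapZ -/f => n2.
rewrite -(ler_pM2l e0) -/(f _).
move: n1 n2 he; set a := f (u _); set b := f (T _ _).
move: (`|_| `^ p) (`|_| `^ _ * _) (dual_map _ _) => x y z; nra.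
Unshelve. all: by end_near. Qed.

(** Both sides are limits of one sequence, since [T (tau n + r) w = T (tau n) (T r w)] as soon as
    [tau n >= 0]. *)
Lemma dual_map_flow u (s r : R) (w : E) : complete_orbit u -> recurrent u -> 0 <= r ->
  dual_map (u (s + r)) (T r w) = dual_map (u s) w.
Proof.
move=> ou ru r0.
have h1 := @dual_map_flow_cvg u s r w ou ru r0.
have := @dual_map_flow_cvg u (s + r) 0 (T r w) ou ru (lexx 0).
rewrite addr0 => h2; rewrite -(cvg_lim _ h2)// -(cvg_lim _ h1)//.
congr (lim _); apply/seteqP; split; apply: near_eq_cvg;
  have /cvgryPge/(_ 0) := tauoo; apply: filterS => n n0;
  by rewrite addr0; case: hT => _ _ -> //.
Qed.

(** In reversed time the norming functionals, and with them their combinations [G], move by the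
    adjoint semigroup ([flow]). Recurrence and weak contractivity then give equal norms as for [u]
    itself. *)
Lemma dual_orbit_stationary u : complete_orbit u -> recurrent u ->
  stationary (fun s => dual (u (- s))).
Proof.
move=> ou ru l.
pose G s := combo (fun s => dual (u (- s))) l s; rewrite -/(G _).
have flow s r w : 0 <= r -> pairing pq (G s) (T r w) = pairing pq (G (s + r)) w.
  move=> r0; rewrite /G /combo.
  elim/big_ind2: _ => [|a b c d h1 h2|i _].
  - by rewrite -[0](subrr 0) !pairingBl !subrr.
  - by rewrite !pairingDl h1 h2.
  rewrite !pairingZl !pairing_dualize; congr (_ * _).
  rewrite -(dual_map_flow (- (s + r + i.2)) w ou ru r0).
  by rewrite (_ : - (s + r + i.2) + r = - (s + i.2)); last by ring.
have rec s : G (s + tau n) @[n --> \oo] --> G s.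
  rewrite /G /combo; apply: cvg_big => [|i _]; first exact: add_continuous.
  apply: cvgZl_tmp; apply/cvgrPdist_le => e e0.
  pose K := (p - 1) * (`|u 0| + `|u 0|) `^ (p - 1 - 1).
  have K0 : 0 < K + 1 by rewrite ltr_wpDl// mulr_ge0 ?powR_ge0 ?(ltW m0).
  have ed : 0 < e / (K + 1) by rewrite divr_gt0.
  have /cvgrPdist_le/(_ _ ed) := ru (- (s + i.2)).
  apply: filterS => n h.
  apply: le_trans (lp_power_lipschitz _ _ _ _ _ m1) _.
  rewrite !(orbit_norm ou ru (- _) 0) mulrA -/K.
  (* Reversed time moves by [- tau n]; stationarity of [u] turns this into the displacement by
     [tau n] that recurrence controls. *)
  have -> : `|u (- (s + i.2)) - u (- (s + tau n + i.2))| =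
      `|u (- (s + i.2)) - u (- (s + i.2) + tau n)|.
    have := stationary_dist (orbit_stationary ou ru) (tau n) 0 (- (s + tau n + i.2)).
    have := stationary_dist (orbit_stationary ou ru) 0 (tau n) (- (s + i.2)).
    rewrite !addr0 => ->; rewrite [RHS]distrC => <-.
    by rewrite (_ : - (s + tau n + i.2) + tau n = - (s + i.2)); last by ring.
  apply: le_trans (_ : (K + 1) * (e / (K + 1)) <= _); last first.
    by rewrite mulrC divfK// gt_eqF.
  by apply: ler_pM => //; rewrite ?lerDl// mulr_ge0 ?powR_ge0 ?(ltW m0).
suff le s t : `|G t| <= `|G s| by move=> s; apply/eqP; rewrite eq_le !le.
(* [G t] attains its norm at [w], and [G (t + tau n)] at [w] equals [G s] at
   [T (tau n + (t - s)) w], bounded by [|G s| * |w|] up to [d]. *)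
pose w := predual p1 pq (G t).
have [w0|w0] := eqVneq w 0.
  have := lp_power_norm p1 (conjugate_gt1' p1 pq) (conjugateC pq) (G t).
  rewrite -[lp_power _ _ _ _]/w w0 normr0 => /esym h.
  by rewrite (powR_eq0_eq0 h).
have nw : 0 < `|w| by rewrite normr_gt0.
rewrite -(ler_pM2r nw) -pairing_predual -/w.
apply/ler_addgt0Pr => d d0.
have cv : pairing pq (G (t + tau n)) w @[n --> \oo] --> pairing pq (G t) w.
  apply/cvgrPdist_le => e e0.
  have ed : 0 < e / `|w| by rewrite divr_gt0.
  have /cvgrPdist_le/(_ _ ed) := rec t; apply: filterS => n h.
  rewrite -pairingBl; apply: le_trans (pairing_le _ _ _) _.
  by rewrite -ler_pdivlMr.
apply: (cvgr_to_le cv).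
have /(tau_shift (t - s)) h2 := @weak_bound _ _ T (dual_map (predual p1 pq (G s))) _ w hw
  (normr_ge0 _) (pairing_le pq (G s)) _ d0.
near=> n.
have n0 : 0 <= tau n + (t - s) by near: n; have /cvgryPge/(_ 0) := @tau_shift (t - s).
have -> : t + tau n = s + (tau n + (t - s)) by ring.
by rewrite -flow//; apply: le_trans (ler_norm _) _; near: n; exact: h2.
Unshelve. all: by end_near. Qed.

End superquadratic.

Theorem complete_orbit_cst u : p <> 2 -> complete_orbit u -> recurrent u ->
  {for 0, continuous u} -> forall s t, u s = u t.
Proof.
move=> p2 ou ru c0; have [plt|pgt|/p2//] := ltgtP p 2.
  exact: (stationary_cst plt (orbit_stationary ou ru) c0).
have m1 : 1 <= p - 1 by rewrite lerBrDr ltW.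
have m0 : 0 < p - 1 by exact: lt_le_trans m1.
pose q := p / (p - 1).
have q1 : 1 <= q by rewrite /q ler_pdivlMr// mul1r gerBl.
have q2 : q < 2.
  by rewrite /q ltr_pdivrMr// mulrBr mulr1 mulr_natl mulr2n -addrA ltrDl subr_gt0.
have pq : (p - 1) * q = p by rewrite /q mulrC divfK// gt_eqF.
pose g s : lp q1 := dualize q1 pq (u (- s)).
have lip s t : `|g s - g t| <=
    (p - 1) * ((`|u 0| + `|u 0|) `^ (p - 1 - 1) * `|u (- s) - u (- t)|).
  apply: le_trans (lp_power_lipschitz _ _ _ _ _ m1) _.
  by rewrite !(orbit_norm ou ru (- _) 0).
have cg : {for 0, continuous g}.
  apply/cvgrPdist_le => e e0.
  pose K := (p - 1) * (`|u 0| + `|u 0|) `^ (p - 1 - 1).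
  have K0 : 0 < K + 1 by rewrite ltr_wpDl// mulr_ge0 ?powR_ge0 ?(ltW m0).
  have ed : 0 < e / (K + 1) by rewrite divr_gt0.
  have : u (- s) @[s --> 0] --> u (- 0).
    apply: (@cvg_comp _ _ _ -%R u _ (nbhs (0 : R))); last by rewrite oppr0; exact: c0.
    by have := @opp_continuous R (0 : R); rewrite /continuous_at oppr0.
  move/cvgrPdist_le/(_ _ ed); apply: filterS => s h.
  apply: le_trans (lip _ _) _; rewrite mulrA -/K.
  apply: le_trans (_ : (K + 1) * (e / (K + 1)) <= _); last first.
    by rewrite mulrC divfK// gt_eqF.
  by apply: ler_pM => //; rewrite ?lerDl// mulr_ge0 ?powR_ge0 ?(ltW m0).
have gcst := stationary_cst q2 (dual_orbit_stationary q1 pgt pq ou ru) cg.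
move=> s t; apply: lp_seqP => k.
have := congr1 (fun f => lp_seq f k) (gcst (- s) (- t)).
(* The duality map is injective: the signed power [p - 1] is undone by its reciprocal. *)
rewrite !lp_powerE !opprK => /(congr1 (sgpow (p - 1)^-1)).
by rewrite !sgpow_comp// divff ?gt_eqF// !sgpow1.
Qed.

End complete_orbits.

(** * Uniform boundedness *)

Section boundedness.
Context (R : realType).

Lemma uniform_boundedness (J : Type) (V : completeNormedModType R) (W : normedModType R)
    (f : J -> V -> W) : (forall j, linear (f j)) ->
  (forall j, exists C, forall x, `|f j x| <= C * `|x|) ->
  (forall x, exists M, forall j, `|f j x| <= M) ->
  exists2 M, 0 <= M & forall j x, `|f j x| <= M * `|x|.
Proof.
move=> flin fbd fpt.
have [||M MP] := @Banach_Steinhauss _ V W (range f) _ _ 1.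
- move=> _ [j _ <-]; split; last exact: flin.
  move=> r; have [C fC] := fbd j; exists (`|C| * `|r|) => x xr.
  apply: le_trans (fC x) _; apply: le_trans (ler_wpM2r (normr_ge0 _) (ler_norm C)) _.
  by rewrite ler_wpM2l// (le_trans xr)// ler_norm.
- by move=> x; have [M fM] := fpt x; exists M => _ [j _ <-]; exact: fM.
exists `|M| => // j x.
have [->|x0] := eqVneq x 0.
  by have [C /(_ 0)] := fbd j; rewrite normr0 !mulr0.
have nx : 0 < `|x| by rewrite normr_gt0.
have fZ a y : f j (a *: y) = a *: f j y.
  have f0 : f j 0 = 0.
    have [C /(_ 0)] := fbd j.
    by rewrite normr0 mulr0 normr_le0 => /eqP.
  by have := flin j a y 0; rewrite !addr0 f0 addr0.
have := MP (f j) (ex_intro2 _ _ j Logic.I erefl) (`|x|^-1 *: x).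
rewrite normrZ normfV normr_id mulVf ?gt_eqF// => /(_ (lexx _)).
rewrite fZ normrZ normfV normr_id ler_pdivrMl// mulrC => /le_trans; apply.
by rewrite ler_wpM2r// ler_norm.
Qed.

Lemma continuous_linear_bound (V W : normedModType R) (f : {linear V -> W}) :
  continuous f -> exists C, forall x, `|f x| <= C * `|x|.
Proof.
move=> /linear_bounded_continuous/linear_boundedP[M [_ fM]].
by exists (M + 1); apply: fM; rewrite ltrDl.
Qed.

(** * Bounds on compact time intervals *)

Section semigroup.
Context (X : completeNormedModType R) (T : R -> {linear X -> X}).
Hypothesis hT : C0_semigroup T.

(** Otherwise there are times [tau n] tending to 0 with operators of norm above [n], although
    [T (tau n) x] converges to [x] for every [x]; this contradicts uniform boundedness. *)
Lemma semigroup_local_bound : exists2 d, 0 < d & exists2 M, 0 <= M &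
  forall t x, 0 <= t <= d -> `|T t x| <= M * `|x|.
Proof.
have [Tc T0 TD Tcv] := hT.
apply: contrapT => H.
have /choice[tau tauP] : forall n : nat, exists t, 0 <= t <= n.+1%:R^-1 /\
    exists x, n%:R * `|x| < `|T t x|.
  move=> n; apply: contrapT => Hn; apply: H.
  exists n.+1%:R^-1; first by rewrite invr_gt0.
  exists n%:R => // t x tn; rewrite leNgt; apply/negP => h.
  by apply: Hn; exists t; split => //; exists x.
have tau0 n : 0 <= tau n by have [/andP[]] := tauP n.
have tau_cvg x : T (tau n) x @[n --> \oo] --> x.
  apply/cvgrPdist_lt => e e0.
  move/cvgrPdist_lt : (Tcv x) => /(_ e e0); rewrite near_withinE.
  move=> /nbhs_ballP[d /= d0 hd].
  near=> n.
  have [->|n0] := eqVneq (tau n) 0; first by rewrite T0 subrr normr0.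
  apply: hd; last by rewrite /= lt_neqAle eq_sym n0 tau0.
  rewrite -ball_normE/= sub0r normrN ger0_norm//.
  have [/andP[_ h] _] := tauP n; apply: le_lt_trans h _.
  by near: n; exact: near_infty_natSinv_lt (PosNum d0).
have [|||M M0 MP] := @uniform_boundedness nat X X (fun n => T (tau n)).
- by move=> n; exact: linearP.
- by move=> n; apply: continuous_linear_bound; exact: Tc.
- move=> x; have : bounded_fun (fun n => T (tau n) x).
    by apply: cvg_seq_bounded; apply/cvg_ex; exists x.
  by move=> [A [_ AP]]; exists (A + 1) => n; apply: AP => //; rewrite ltrDl.
have [n Mn] : exists n : nat, M <= n%:R.
  by exists (Num.truncn M).+1; apply/ltW/truncnS_gt.
have [_ [x hx]] := tauP n.
have := MP n x; rewrite leNgt => /negP; apply.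
by apply: le_lt_trans hx; rewrite ler_wpM2r.
Unshelve. all: by end_near. Qed.

Lemma semigroup_interval_bound (b : R) : exists2 M, 0 <= M &
  forall t x, 0 <= t <= b -> `|T t x| <= M * `|x|.
Proof.
have [Tc T0 TD Tcv] := hT.
have [d d0 [M M0 MP]] := semigroup_local_bound.
have step (n : nat) : exists2 K, 0 <= K &
    forall t x, 0 <= t <= n%:R * d -> `|T t x| <= K * `|x|.
  elim: n => [|n [K K0 KP]].
    exists 1 => // t x; rewrite mul0r -eq_le => /eqP <-.
    by rewrite T0 mul1r.
  (* The three terms serve [t] past both [n d] and [d], [t <= n d], and [t <= d]. *)
  exists (M * K + K + M); first by rewrite !addr_ge0// mulr_ge0.
  move=> t x /andP[t0 tn]; have [tnd|/ltW ntd] := leP t (n%:R * d).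
    apply: le_trans (KP t x _) _; first by rewrite t0.
    by rewrite addrAC mulrDl lerDr mulr_ge0// addr_ge0// mulr_ge0.
  have [td|/ltW dt] := leP t d.
    apply: le_trans (MP t x _) _; first by rewrite t0.
    by rewrite mulrDl lerDr mulr_ge0// addr_ge0// mulr_ge0.
  rewrite -(subrKC d t) TD ?subr_ge0 ?(ltW d0)//.
  apply: le_trans (MP _ _ _) _; first by rewrite lexx (ltW d0).
  rewrite -addrA mulrDl -mulrA; apply: ler_wpDr; first by rewrite mulr_ge0// addr_ge0.
  rewrite ler_wpM2l// KP// subr_ge0 dt lerBlDl.
  by rewrite -[X in X + _]mul1r -mulrDl addrC natr1.
have [K K0 KP] := step (Num.truncn (b / d)).+1.
exists K => // t x /andP[t0 tb]; apply: KP; rewrite t0 (le_trans tb)//.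
by rewrite -ler_pdivrMr// ltW// truncnS_gt.
Qed.

End semigroup.

(** * Weakly bounded sequences in [l^p] *)

Section weakly_bounded.
Context (p : R) (p1 : 1 <= p).
Local Notation E := (lp p1).
Local Notation L1 := (lp (lexx (1 : R))).

(** The duality map rescaled to a functional of norm at most 1 with value [|u|] at [u]; the
    convention [0^-1 = 0] keeps this true at [u = 0]. *)
Let phi (u w : E) : R := (`|u| `^ (p - 1))^-1 * dual_map u w.

Let phi_le u w : `|phi u w| <= `|w|.
Proof.
rewrite /phi normrM normfV (ger0_norm (powR_ge0 _ _)).
have [->|u0] := eqVneq (`|u| `^ (p - 1)) 0; first by rewrite invr0 mul0r.
by rewrite ler_pdivrMl ?dual_map_le// lt_neqAle eq_sym u0 powR_ge0.
Qed.

Let phi_self u : phi u u = `|u|.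
Proof.
rewrite /phi dual_map_self.
have [->|u0] := eqVneq u 0.
  by rewrite normr0 [X in _ * X]powR0 ?mulr0// gt_eqF// (lt_le_trans ltr01).
have nu : 0 < `|u| by rewrite normr_gt0.
rewrite -(@mulr_powRB1 _ `|u| p) ?(lt_le_trans ltr01)// mulrCA mulVf ?mulr1//.
by rewrite gt_eqF// powR_gt0.
Qed.

Let lp1_bound (a : L1) (c : nat -> R) (C : R) : (forall n, `|c n| <= C) ->
  dot_bound (lp_seq a) c (C * `|a|).
Proof.
move=> cC n; have C0 : 0 <= C by exact: le_trans (cC 0%N).
apply: le_trans (_ : \sum_(0 <= k < n) C * `|lp_seq a k| `^ 1 <= _).
  by apply: ler_sum => k _; rewrite powRr1// normrM mulrC ler_wpM2r.
rewrite -mulr_sumr ler_wpM2l//.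
by have := lp_psum_le a n; rewrite [leRHS]powRr1.
Qed.

Let dot_delta (m : nat) (c : nat -> R) : dot (fun j => (j == m)%:R) c = c m.
Proof.
apply/cvg_lim => //; apply: cvg_near_cst; exists m.+1 => // n /= mn.
rewrite /series/= big_mkord (bigD1 (Ordinal mn))//= eqxx mul1r big1 ?addr0//.
by move=> i; rewrite -val_eqE/= => /negbTE ->; rewrite mul0r.
Qed.

(* Banach-Steinhaus on [l^1]: integrable combinations of norming functionals of the
   [u n] are continuous, so [a |-> sum_n a n * phi n (u m)] is pointwise bounded in [m]. *)
Lemma weakly_bounded_bounded (u : nat -> E) :
  (forall f : {scalar E}, continuous f -> exists K, forall n, `|f (u n)| <= K) ->
  exists K, forall n, `|u n| <= K.
Proof.
move=> wb.
pose L (m : nat) (a : L1) : R := dot (lp_seq a) (fun n => phi (u n) (u m)).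
have Lb m (a : L1) : dot_bound (lp_seq a) (fun n => phi (u n) (u m)) (`|u m| * `|a|).
  by apply: lp1_bound => n; exact: phi_le.
have [|||M M0 MP] := @uniform_boundedness nat L1 R^o L.
- move=> m k x y; rewrite /L dotC.
  have b (z : L1) : dot_bound (fun n => phi (u n) (u m)) (lp_seq z) (`|u m| * `|z|).
    by move=> n; under eq_bigr do rewrite mulrC; exact: Lb.
  rewrite (_ : lp_seq (k *: x + y) = fun n => lp_seq (k *: x) n + lp_seq y n)//.
  rewrite (dotDr (b (k *: x)) (b y)) dotC [in X in _ + X]dotC; congr +%R.
  by rewrite dotC (_ : lp_seq (k *: x) = fun n => k * lp_seq x n)// (dotZr _ (b x)) dotC.
- by move=> m; exists `|u m| => a; exact/dot_le/Lb.
- move=> a.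
  pose F (w : E) : R := dot (lp_seq a) (fun n => phi (u n) w).
  have Fb w : dot_bound (lp_seq a) (fun n => phi (u n) w) (`|w| * `|a|).
    by apply: lp1_bound => n; exact: phi_le.
  have Flin : linear_for *%R F.
    move=> k x y; rewrite /F.
    have -> : (fun n => phi (u n) (k *: x + y)) =
        (fun n => phi (u n) (k *: x) + phi (u n) y).
      by apply/funext => n; rewrite /phi dual_mapD mulrDr.
    rewrite (dotDr (Fb (k *: x)) (Fb y)); congr +%R.
    rewrite -(dotZr _ (Fb x)); congr dot; apply/funext => n.
    by rewrite /phi dual_mapZ mulrCA.
  pose f : {scalar E} := HB.pack F (GRing.isLinear.Build _ _ _ _ F Flin).
  apply: (wb f); apply: (@lipschitz_linear_continuous _ _ _ _ `|a|) => [x y|x].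
    exact: (linearB f).
  by rewrite mulrC; exact/dot_le/Fb.
(* At the [m]-th unit vector [L m] is the norming functional of [u m] evaluated at [u m], that is
   [|u m|]. *)
exists M => m; have [d dE d1] := lp_delta (lexx (1 : R)) m.
have := MP m d; rewrite /L dE dot_delta phi_self ger0_norm// => /le_trans; apply.
by rewrite ler_piMr.
Qed.

End weakly_bounded.

Section global_bound.
Context (p : R) (p1 : 1 <= p).
Local Notation E := (lp p1).
Context (T : R -> {linear E -> E}).
Hypothesis hT : C0_semigroup T.
Hypothesis hw : weakly_asymptotically_contractive T.

(** Weak contractivity bounds [f (T t x)] for late [t], the interval bound for the rest. So orbits
    are weakly bounded, hence bounded, and uniform boundedness applies. *)
Lemma semigroup_global_bound : exists2 M, 0 <= M &
  forall t x, 0 <= t -> `|T t x| <= M * `|x|.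
Proof.
have [Tc T0 TD Tcv] := hT.
have wb (x : E) (f : {scalar E}) : continuous f ->
    exists K, forall t, 0 <= t -> `|f (T t x)| <= K.
  move=> cf.
  have [C fC] : exists C, forall w, `|f w| <= C * `|w|.
    exact: (@continuous_linear_bound E R^o f cf).
  have C0 : 0 <= `|C| by [].
  have fC' w : `|f w| <= `|C| * `|w|.
    by apply: le_trans (fC w) _; rewrite ler_wpM2r// ler_norm.
  have [A [_ AP]] := weak_bound x hw C0 fC' ltr01.
  have [M M0 MP] := semigroup_interval_bound hT A.
  exists (`|C| * `|x| + 1 + `|C| * (M * `|x|)) => t t0.
  have [tA|At] := leP t A.
    apply: le_trans (fC' _) _; apply: ler_wpDl; first by rewrite addr_ge0// mulr_ge0.
    by rewrite ler_wpM2l// MP// t0.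
  by apply: le_trans (AP t At) _; rewrite lerDl !mulr_ge0.
have [|||M M0 MP] := @uniform_boundedness R E E (fun t => T `|t|).
- by move=> t; exact: linearP.
- by move=> t; apply: continuous_linear_bound; exact: Tc.
- move=> x; apply: contrapT => H.
  have /choice[tau tauP] : forall n : nat, exists t : R, n%:R < `|T `|t| x|.
    move=> n; apply: contrapT => Hn; apply: H; exists n%:R => t.
    by rewrite leNgt; apply/negP => h; apply: Hn; exists t.
  have [|K KP] := @weakly_bounded_bounded _ p1 (fun n => T `|tau n| x).
    by move=> f cf; have [K KP] := wb x f cf; exists K => n; exact: KP.
  have := lt_le_trans (tauP (Num.truncn K).+1) (KP _).
  by rewrite ltNge ltW// truncnS_gt.
by exists M => // t x t0; have := MP t x; rewrite ger0_norm.
Qed.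

End global_bound.
End boundedness.

(** * Imaginary eigenvalues *)

Section complexification_theory.
Context (R : realType) (X : completeNormedModType R) (XC : complexification X).
Local Open Scope complex_scope.
Local Notation inX := (cplx_in XC).

Lemma cplx_in0 : inX 0 = 0.
Proof.
have := cplx_in_linear XC 1 0 0; rewrite scaler0 addr0 rmorph1 scale1r => h.
by apply: (addrI (inX 0)); rewrite -h addr0.
Qed.

Lemma cplx_inD x y : inX (x + y) = inX x + inX y.
Proof. by have := cplx_in_linear XC 1 x y; rewrite !scale1r. Qed.

Lemma cplx_inZ (a : R) x : inX (a *: x) = a%:C *: inX x.
Proof. by have := cplx_in_linear XC a x 0; rewrite !addr0 cplx_in0 addr0. Qed.

Lemma cplx_inN x : inX (- x) = - inX x.
Proof. by rewrite -scaleN1r cplx_inZ rmorphN rmorph1 scaleN1r. Qed.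

Lemma cplx_scale (c : R[i]) x y :
  c *: (inX x + 'i%R *: inX y) =
  inX (complex.Re c *: x - complex.Im c *: y) +
  'i%R *: inX (complex.Re c *: y + complex.Im c *: x).
Proof.
rewrite {1}(complexE c) complexiE.
set a := complex.Re c; set b := complex.Im c.
rewrite !cplx_inD cplx_inN !cplx_inZ scalerDl !scalerDr !scalerA.
rewrite [in 'i * b%:C * 'i]mulrAC -expr2 sqrCi mulN1r scaleNr.
rewrite -!addrA; congr (_ + _); rewrite ['i * a%:C]mulrC.
by rewrite addrA [RHS]addrC.
Qed.

Lemma cplx_eq x y x' y' : inX x + 'i%R *: inX y = inX x' + 'i%R *: inX y' ->
  x = x' /\ y = y'.
Proof.
move=> h; split.
  by have := congr1 (@cplx_re _ _ XC) h; rewrite !cplx_reK.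
by have := congr1 (@cplx_im _ _ XC) h; rewrite !cplx_imK.
Qed.

End complexification_theory.

Lemma right_difference_quotient (R : realType) (f : R -> R) (d : R) :
  is_derive (0 : R) (1 : R) f d -> h^-1 * (f h - f 0) @[h --> 0^'+] --> d.
Proof.
move=> [fd <-]; have : h^-1 * (f h - f 0) @[h --> 0^'] --> 'D_1 f 0.
  apply: cvg_trans fd; apply: near_eq_cvg; near=> h.
  by rewrite /= /GRing.scale/= mulr1 addr0.
apply: cvg_trans; apply: cvg_app => P; rewrite /dnbhs /at_right /within /=.
by apply: (@filterS _ (nbhs (0 : R))) => z Pz z0; apply: Pz; rewrite gt_eqF.
Unshelve. all: by end_near. Qed.

Section rotation.
Context (R : realType) (p : R) (p1 : 1 <= p).
Local Notation X := (lp p1).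
Context (T : R -> {linear X -> X}).
Hypothesis hT : C0_semigroup T.
Local Notation A := (generator T).

(* The defect of the rotated orbit is additive up to the action of [T], and [o(h)];
   subdividing [0, t] makes it vanish. *)
Lemma rotated_orbit (b : R) (x y : X) : dom A x -> dom A y ->
  A x = - b *: y -> A y = b *: x ->
  forall t, 0 <= t -> cos (b * t) *: T t x + sin (b * t) *: T t y = x.
Proof.
move=> Dx Dy Ax Ay t t0.
have [Tc T0 TD Tcv] := hT.
(* [al] and [ga] are the real and imaginary parts of [exp (- i b t) T t z - z] for [z = x + i y]. *)
pose al t := cos (b * t) *: T t x + sin (b * t) *: T t y - x.
pose ga t := cos (b * t) *: T t y - sin (b * t) *: T t x - y.
suff : al t = 0 by move=> /eqP; rewrite subr_eq0 => /eqP.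
have alD s h : 0 <= s -> 0 <= h ->
    al (s + h) = al s + (cos (b * s) *: T s (al h) + sin (b * s) *: T s (ga h)).
  move=> s0 h0; rewrite /al /ga !linearB/= !linearD/= !linearZ/= !TD//.
  rewrite mulrDr cosD sinD; apply: lp_seqP => k.
  by rewrite !(lp_seqD, lp_seqN, lp_seqZ); ring.
have [M M0 MP] := semigroup_interval_bound hT t.
have aln h n : 0 <= h -> n%:R * h <= t -> `|al (n%:R * h)| <= n%:R * (M * (`|al h| + `|ga h|)).
  move=> h0; elim: n => [|n ih] nh.
    by rewrite !mul0r /al mulr0 cos0 sin0 T0 scale1r scale0r addr0 subrr normr0.
  have nh' : n%:R * h <= t.
    by apply: le_trans nh; rewrite ler_wpM2r// ler_nat.
  have nh0 : 0 <= n%:R * h by rewrite mulr_ge0.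
  rewrite -natr1 mulrDl mul1r alD// mulrDl mul1r.
  apply: le_trans (ler_normD _ _) _; apply: lerD; first exact: ih.
  apply: le_trans (ler_normD _ _) _; rewrite mulrDr !normrZ.
  have bd (c : R) z : `|c| <= 1 -> `|c| * `|T (n%:R * h) z| <= M * `|z|.
    move=> c1; rewrite -[leRHS]mul1r; apply: ler_pM => //.
    by apply: MP; rewrite nh0.
  by apply: lerD; apply: bd; [exact: cos_max|exact: sin_max].
have dc : is_derive (0 : R) (1 : R) (fun t => cos (b * t)) 0.
  have h1 : is_derive (0 : R) (1 : R) (fun s : R => b * s) b.
    by apply: is_derive_eq; rewrite /GRing.scale/= mulr1.
  have := @is_derive1_comp _ cos (fun s : R => b * s) 0 _ _ (is_derive_cos _) h1.
  by rewrite mulr0 sin0 oppr0 mul0r.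
have ds : is_derive (0 : R) (1 : R) (fun t => sin (b * t)) b.
  have h1 : is_derive (0 : R) (1 : R) (fun s : R => b * s) b.
    by apply: is_derive_eq; rewrite /GRing.scale/= mulr1.
  have := @is_derive1_comp _ sin (fun s : R => b * s) 0 _ _ (is_derive_sin _) h1.
  by rewrite mulr0 cos0 mul1r.
have cos_cvg : cos (b * h) @[h --> 0^'+] --> (1 : R).
  have c0 : {for 0, continuous (fun t => cos (b * t))}.
    by apply: differentiable_continuous; apply/derivable1_diffP; case: dc.
  have <- : cos (b * 0) = 1 by rewrite mulr0 cos0.
  by apply: cvg_at_right_filter; exact: c0.
(* Covers both parts: [(x, y, b, sin)] for [al] and [(y, x, - b, - sin)] for [ga]. *)
have defect (x' y' : X) (c : R) (sn : R -> R) : dom A x' -> A x' = - c *: y' ->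
    sn 0 = 0 -> is_derive (0 : R) (1 : R) sn c ->
    h^-1 *: (cos (b * h) *: T h x' + sn h *: T h y' - x') @[h --> 0^'+] --> (0 : X).
  move=> Dx' Ax' sn0 ds'.
  have : cos (b * h) *: (h^-1 *: (T h x' - x')) + (h^-1 * (cos (b * h) - 1)) *: x'
      + (h^-1 * sn h) *: T h y' @[h --> 0^'+] --> 1 *: A x' + 0 *: x' + c *: y'.
    apply: cvgD; last first.
      apply: cvgZ; last exact: Tcv.
      have := right_difference_quotient ds'.
      by under eq_fun do rewrite sn0 subr0.
    apply: cvgD; first by apply: cvgZ => //; exact: Dx'.
    apply: cvgZ; last exact: cvg_cst.
    have := right_difference_quotient dc.
    by under eq_fun do rewrite mulr0 cos0.
  rewrite scale1r scale0r addr0 Ax' scaleNr addNr.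
  apply: cvg_trans; apply: near_eq_cvg; near=> h.
  by apply: lp_seqP => k; rewrite /= !(lp_seqD, lp_seqN, lp_seqZ); ring.
have small : h^-1 * (`|al h| + `|ga h|) @[h --> 0^'+] --> (0 : R).
  have s0 : sin (b * 0) = 0 by rewrite mulr0 sin0.
  have dal := defect x y b _ Dx Ax s0 ds.
  have Ay' : A y = - - b *: x by rewrite opprK.
  have s0' : - sin (b * 0) = 0 by rewrite s0 oppr0.
  have dsN : is_derive (0 : R) (1 : R) (fun t => - sin (b * t)) (- b).
    exact: (@is_deriveN _ _ _ _ _ _ _ ds).
  have dga := defect y x (- b) _ Dy Ay' s0' dsN.
  suff : h^-1 * (`|al h| + `|ga h|) @[h --> 0^'+] --> `|0 : X| + `|0 : X|.
    by rewrite normr0 addr0.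
  have : `|h^-1 *: al h| + `|h^-1 *: ga h| @[h --> 0^'+] --> `|0 : X| + `|0 : X|.
    apply: cvgD; apply: cvg_norm; first exact: dal.
    apply: cvg_trans dga; apply: near_eq_cvg; near=> h.
    by rewrite /ga scaleNr.
  apply: cvg_trans; apply: near_eq_cvg; near=> h => /=.
  have h0 : 0 < h by near: h; exact: nbhs_right_gt.
  by rewrite !normrZ gtr0_norm ?invr_gt0// mulrDr.
have [->|tn0] := eqVneq t 0.
  by rewrite /al mulr0 cos0 sin0 T0 scale1r scale0r addr0 subrr.
have tp : 0 < t by rewrite lt_neqAle eq_sym tn0.
apply/eqP; rewrite -normr_le0.
(* With [h = t / (n + 1)], the factor [n + 1] in [aln] is [t / h], so the bound is [M * t] times a
   quotient tending to 0. *)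
have lim0 : M * t * ((t / n.+1%:R)^-1 * (`|al (t / n.+1%:R)| + `|ga (t / n.+1%:R)|))
    @[n --> \oo] --> M * t * 0.
  apply: cvgM; first exact: cvg_cst.
  apply: (@cvg_comp _ _ _ (fun n : nat => t / n.+1%:R)
    (fun h => h^-1 * (`|al h| + `|ga h|)) _ (0^'+)) small.
  move=> P; rewrite /at_right /within /= => /nbhs_ballP[e /= e0 He].
  have et : 0 < e / t by rewrite divr_gt0.
  near=> n; apply: He; last by rewrite divr_gt0.
  rewrite -ball_normE/= sub0r normrN gtr0_norm ?divr_gt0//.
  rewrite mulrC -ltr_pdivlMr//.
  by near: n; exact: near_infty_natSinv_lt (PosNum et).
rewrite -(mulr0 (M * t)); apply: (cvgr_to_ge lim0); apply: nearW => n.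
have h0 : 0 < t / n.+1%:R by rewrite divr_gt0.
have := aln (t / n.+1%:R) n.+1 (ltW h0).
rewrite mulrC divfK ?pnatr_eq0// lexx => /(_ isT)/le_trans; apply.
rewrite le_eqVlt; apply/orP; left; apply/eqP.
rewrite invf_div; field.
by rewrite gt_eqF.
Unshelve. all: by end_near. Qed.

End rotation.

Section no_rotation.
Context (R : realType) (p : R) (p1 : 1 <= p).
Local Notation X := (lp p1).
Context (T : R -> {linear X -> X}).
Hypotheses (p2 : p <> 2) (hT : C0_semigroup T).
Hypothesis hw : weakly_asymptotically_contractive T.
Local Notation A := (generator T).

Lemma no_rotation (b : R) (x y : X) : b != 0 -> dom A x -> dom A y ->
  A x = - b *: y -> A y = b *: x -> x = 0 /\ y = 0.
Proof.
move=> b0 Dx Dy Ax Ay.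
have rx := rotated_orbit hT Dx Dy Ax Ay.
have ry t : 0 <= t -> cos (b * t) *: T t y - sin (b * t) *: T t x = y.
  move=> t0; have Ay' : A y = - - b *: x by rewrite opprK.
  have := rotated_orbit hT Dy Dx Ay' Ax t0.
  by rewrite mulNr cosN sinN scaleNr.
have Tx t : 0 <= t -> T t x = cos (b * t) *: x - sin (b * t) *: y.
  move=> t0; apply: lp_seqP => k.
  have := congr1 (fun z => lp_seq z k) (ry t t0); have := congr1 (fun z => lp_seq z k) (rx t t0).
  rewrite !(lp_seqD, lp_seqN, lp_seqZ) => <- <-.
  by rewrite -[LHS]mul1r -(cos2Dsin2 (b * t)); ring.
have Ty t : 0 <= t -> T t y = sin (b * t) *: x + cos (b * t) *: y.
  move=> t0; apply: lp_seqP => k.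
  have := congr1 (fun z => lp_seq z k) (ry t t0); have := congr1 (fun z => lp_seq z k) (rx t t0).
  rewrite !(lp_seqD, lp_seqN, lp_seqZ) => <- <-.
  by rewrite -[LHS]mul1r -(cos2Dsin2 (b * t)); ring.
pose v s := cos (b * s) *: x - sin (b * s) *: y.
have orb : complete_orbit T v.
  move=> r s r0; rewrite /v linearB !linearZ/= Tx// Ty// mulrDr cosD sinD.
  by apply: lp_seqP => k; rewrite !(lp_seqD, lp_seqN, lp_seqZ); ring.
(* Multiples of the period; the modulus of [b] makes them tend to [+oo] for either sign. *)
pose tau (n : nat) : R := (pi *+ 2 *+ n) / `|b|.
have per (f : R -> R) : periodic f (pi *+ 2) -> forall s n, f (b * (s + tau n)) = f (b * s).
  move=> fp s n; rewrite mulrDr /tau mulrCA.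
  have [b_gt|b_lt|b00] := ltgtP 0 b; last by move: b0; rewrite -b00 eqxx.
    by rewrite gtr0_norm// divff// mulr1 periodicn.
  rewrite ltr0_norm// invrN mulrN divff// mulrN1.
  by rewrite -[in RHS](subrK (pi *+ 2 *+ n) (b * s)) (periodicn fp).
have tauoo : tau n @[n --> \oo] --> +oo_R.
  apply/cvgryPge => B; near=> n.
  rewrite /tau ler_pdivlMr ?normr_gt0// -[pi *+ 2 *+ n]mulr_natl -ler_pdivrMr; last first.
    by rewrite mulr2n addr_gt0// pi_gt0.
  by near: n; exact: nbhs_infty_ger.
have rec : recurrent tau v.
  move=> s; apply: cvg_near_cst; apply: nearW => n.
  by rewrite /v (per _ (@cosD2pi R)) (per _ (@sinD2pi R)).
have cv : {for 0, continuous v}.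
  have cs (f df : R -> R) : (forall s : R, is_derive s (1 : R) f (df s)) ->
      {for 0, continuous (fun s => f (b * s))}.
    move=> fd; apply: differentiable_continuous; apply/derivable1_diffP.
    have h1 : is_derive (0 : R) (1 : R) (fun s : R => b * s) b.
      by apply: is_derive_eq; rewrite /GRing.scale/= mulr1.
    by case: (@is_derive1_comp _ f (fun s : R => b * s) 0 _ _ (fd _) h1).
  apply: cvgB; apply: cvgZ; do ?exact: cvg_cst.
    exact: (cs _ _ (@is_derive_cos R)).
  exact: (cs _ _ (@is_derive_sin R)).
have vc := complete_orbit_cst hT hw tauoo p2 orb rec cv.
have half0 (z : X) : - z = z -> z = 0.
  move=> h; apply: lp_seqP => k; have := congr1 (fun z => lp_seq z k) h.
  by rewrite lp_seqN lp_seq0 => /eqP; rewrite eqNr => /eqP.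
(* [v] is [- x] at [pi / b] and [x] at 0; it is [- y] at [pi / (2 b)] and [y] at the opposite
   time. *)
split; apply: half0.
  have bE : b * (pi / b) = pi by rewrite mulrC divfK.
  have := vc (pi / b) 0; rewrite /v bE mulr0 cos0 sin0 cospi sinpi.
  by rewrite !scale0r !subr0 scale1r scaleN1r.
have bE : b * (pi / 2 / b) = pi / 2 by rewrite mulrC divfK.
have := vc (pi / 2 / b) (- (pi / 2 / b)); rewrite /v mulrN bE cosN sinN.
by rewrite cos_pihalf sin_pihalf !scale0r !sub0r scale1r scaleN1r opprK.
Unshelve. all: by end_near. Qed.

Lemma point_spectrum_imaginary_axis (XC : complexification X) :
  point_spectrum XC A `&` imaginary_axis R `<=` [set 0].
Proof.
move=> l [[z [[x Dx [y Dy <-]] z0 /=]]]; rewrite cplx_reK cplx_imK => e l0.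
rewrite /imaginary_axis /= in l0.
move: e; rewrite cplx_scale l0 !scale0r sub0r add0r -!scaleNr => /cplx_eq[Ax Ay].
have [b0|b0] := eqVneq (complex.Im l) 0.
  by rewrite /= (complexE l) l0 b0 mulr0 addr0.
have [x0 y0] := no_rotation b0 Dx Dy Ax Ay.
by move: z0; rewrite x0 y0 cplx_in0 scaler0 addr0 eqxx.
Qed.

End no_rotation.

(** * Strong convergence *)

Lemma ultra_fmap (T U : Type) (f : T -> U) (F : set_system T) :
  UltraFilter F -> UltraFilter (f @ F).
Proof.
move=> FU; split; first exact: fmap_proper_filter.
move=> G GG FG; apply/seteqP; split => // A GA.
have [//|nA] := in_ultra_setVsetC (f @^-1` A) FU.
have /(filterI GA) : G (~` A) by exact: FG.
by rewrite setICr => /filter_not_empty.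
Qed.

Section generator_domain.
Context (R : realType) (X : completeNormedModType R) (T : R -> {linear X -> X}).
Hypothesis hT : C0_semigroup T.
Local Notation A := (generator T).

Lemma generatorP (x y : X) : t^-1 *: (T t x - x) @[t --> 0^'+] --> y ->
  dom A x /\ A x = y.
Proof.
by move=> h; split; [apply/cvg_ex; exists y|exact: cvg_lim h].
Qed.

Lemma generator_linear (a : R) (x y : X) : dom A x -> dom A y ->
  dom A (a *: x + y) /\ A (a *: x + y) = a *: A x + A y.
Proof.
move=> Dx Dy; apply: generatorP.
have : a *: (t^-1 *: (T t x - x)) + t^-1 *: (T t y - y) @[t --> 0^'+] --> a *: A x + A y.
  by apply: cvgD; [apply: cvgZl_tmp; exact: Dx|exact: Dy].
apply: cvg_trans; apply: near_eq_cvg; apply: nearW => t /=.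
rewrite linearP scalerA mulrC -scalerA -scalerDr scalerBr opprD.
by rewrite addrACA.
Qed.

Lemma generator0 : dom A 0 /\ A 0 = 0.
Proof.
apply: generatorP; apply: cvg_near_cst; apply: nearW => t.
by rewrite linear0 subrr scaler0.
Qed.

Lemma generator_semigroup (s : R) (x : X) : 0 <= s -> dom A x ->
  dom A (T s x) /\ A (T s x) = T s (A x).
Proof.
move=> s0 Dx; have [Tc T0 TD Tcv] := hT; apply: generatorP.
have : T s (t^-1 *: (T t x - x)) @[t --> 0^'+] --> T s (A x).
  by apply: (@cvg_comp _ _ _ _ (T s) _ _ _ Dx); exact: Tc.
apply: cvg_trans; apply: near_eq_cvg; near=> t.
have t0 : 0 <= t by near: t; exact: nbhs_right_ge.
by rewrite /= linearZ/= linearB/= -!TD// [s + t]addrC.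
Unshelve. all: by end_near. Qed.

Context (XC : complexification X).
Local Open Scope complex_scope.
Local Notation inX := (cplx_in XC).

(** The resolvent equation gives [x = Re l a - Im l b - A a] with [a], [b] in the domain. Difference
    quotients of the orbit of [a] lie in the domain and approximate [A a]. *)
Lemma resolvent_dense (l : R[i]) (S : {linear XC -> XC}) :
  is_resolvent (complexify XC A) l S ->
  forall (x : X) e, 0 < e -> exists2 d, dom A d & `|x - d| < e.
Proof.
move=> [_ Sdom _] x e e0.
have [[a Da [b Db Sab]]] := Sdom (inX x).
rewrite -Sab /= cplx_reK cplx_imK cplx_scale.
have -> : inX x = inX x + 'i%R *: inX 0 by rewrite cplx_in0 scaler0 addr0.
move=> h.
have [xE _] : complex.Re l *: a - complex.Im l *: b - A a = x /\
    complex.Re l *: b + complex.Im l *: a - A b = 0.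
  apply: (@cplx_eq _ _ XC).
  by rewrite -h !cplx_inD !cplx_inN !scalerDr !scalerN opprD addrACA.
have cv : complex.Re l *: a - complex.Im l *: b - t^-1 *: (T t a - a) @[t --> 0^'+] --> x.
  by rewrite -xE; apply: cvgB; [exact: cvg_cst|exact: Da].
move/cvgrPdist_lt : cv => /(_ e e0) cv.
have [t [t0 te]] : exists t, 0 <= t /\
    `|x - (complex.Re l *: a - complex.Im l *: b - t^-1 *: (T t a - a))| < e.
  near (0:R)^'+ => t; exists t; split; first by near: t; exact: nbhs_right_ge.
  by near: t.
eexists; last exact: te.
have [Dta _] := generator_semigroup t0 Da.
have [D1 _] := generator_linear (-1) Da Dta.
have [D2 _] := generator_linear (- t^-1) D1 generator0.1.
have [D3 _] := generator_linear (- complex.Im l) Db D2.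
have [D4 _] := generator_linear (complex.Re l) Da D3.
move: D4; rewrite addr0 scaleN1r !scaleNr [- a + _]addrC.
by rewrite addrA.
Unshelve. all: by end_near. Qed.

(** For [x] in the domain, [T t x = S (l T t x - T t (A x))] stays in a multiple of a compact set,
    where ultrafilters converge. Density of the domain and the bound [M] extend this to all [x]. *)
Lemma resolvent_orbit_ultra_cvg (M : R) (H : set_system R) : 0 <= M ->
  (forall t x, 0 <= t -> `|T t x| <= M * `|x|) ->
  UltraFilter H -> +oo_R `<=` H ->
  some_resolvent_compact (complexify XC A) ->
  forall x, cvg (T t x @[t --> H]).
Proof.
move=> M0 MP HU Hoo [l [S [rS Scompact]]].
have [Scont Sdom Sinv] := rS.
have H0 : H [set t | 0 <= t] by apply: Hoo; exact: nbhs_pinfty_ge.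
suff domcvg (x : X) : dom A x -> cvg (T t x @[t --> H]).
  move=> x; apply: cauchy_cvg; apply: cauchy_exP => e e0.
  have e2 : 0 < e / 2 / (M + 1) by rewrite !divr_gt0// ltr_wpDl.
  have [d Dd xd] := resolvent_dense rS x e2.
  have /cvg_ex[y dy] := domcvg d Dd.
  exists y; have e20 : 0 < e / 2 by rewrite divr_gt0.
  move/cvgrPdist_lt : dy => /(_ _ e20) dy.
  suff : \forall t \near H, ball y e (T t x) by [].
  near=> t; rewrite -ball_normE/=.
  have t0 : 0 <= t by near: t; exact: H0.
  have -> : y - T t x = (y - T t d) - T t (x - d) by rewrite linearB/= opprB addrA subrK.
  apply: le_lt_trans (ler_normB _ _) _; rewrite [ltRHS]splitr ltr_leD//.
    by near: t.
  apply: le_trans (MP _ _ t0) _; apply: le_trans (_ : (M + 1) * (e / 2 / (M + 1)) <= _).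
    by apply: ler_pM => //; [rewrite lerDl|exact: ltW].
  by rewrite mulrC divfK// gt_eqF// ltr_wpDl.
move=> Dx.
(* Bounds the norm of [l T t x - T t (A x)]; adding 1 makes it positive. The norm in a complex space
   is a complex number, whence [complex.Re]. *)
pose rho : R := complex.Re `|l| * (M * `|x|) + M * `|A x| + 1.
have l0 : `|l| = (complex.Re `|l|)%:C.
  by rewrite normc_def/=.
have rl0 : 0 <= complex.Re `|l| by rewrite -lecR -l0 normr_ge0.
have rho0 : 0 < rho by rewrite ltr_wpDl// !addr_ge0 ?mulr_ge0.
pose u t := (rho^-1)%:C *: inX (T t x).
have uK t : 0 <= t -> closure (S @` [set z | `|z| <= 1]) (u t).
  move=> t0; apply: subset_closure.
  have [Dt At] := generator_semigroup t0 Dx.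
  pose w := l *: inX (T t x) - inX (T t (A x)).
  have Sw : S w = inX (T t x).
    pose z := inX (T t x) + 'i%R *: inX 0.
    have zE : z = inX (T t x) by rewrite /z cplx_in0 scaler0 addr0.
    have AE : complexify XC A z = inX (A (cplx_re z)) + 'i%R *: inX (A (cplx_im z)) by [].
    rewrite cplx_reK cplx_imK At generator0.2 cplx_in0 scaler0 addr0 in AE.
    rewrite /w -[in l *: _]zE -AE Sinv// zE.
    by exists (T t x) => //; exists 0; [exact: generator0.1|exact: zE].
  exists ((rho^-1)%:C *: w); last by rewrite linearZ/= Sw.
  rewrite /= normrZ normc_def/= expr0n addr0 sqrtr_sqr ger0_norm ?invr_ge0 ?(ltW rho0)//.
  have : `|w| <= rho%:C.
    apply: le_trans (ler_normB _ _) _; rewrite normrZ !cplx_in_norm l0 -rmorphM -rmorphD lecR.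
    rewrite /rho -addrA; apply: lerD; first by rewrite ler_wpM2l// MP.
    by apply: le_trans (MP _ _ t0) _; rewrite lerDl.
  move=> h; apply: le_trans (_ : (rho^-1)%:C * rho%:C <= _).
    by apply: ler_wpM2l => //; rewrite lecR invr_ge0 ltW.
  by rewrite -rmorphM mulVf ?gt_eqF// lexx.
have uH : (u @ H) (closure (S @` [set z | `|z| <= 1])).
  exact: (@filterS _ H _ [set t | 0 <= t] _ uK H0).
have := Scompact; rewrite /compact_operator compact_ultra.
move=> /(_ (u @ H) (ultra_fmap u HU) uH)[k [_ uk]].
apply/cvg_ex; exists (cplx_re (rho%:C *: k)).
apply/cvgrPdist_lt => e e0.
have re0 : 0 < (e / rho)%:C :> R[i] by rewrite ltcR divr_gt0.
move/cvgrPdist_lt : uk => /(_ _ re0); apply: filterS => t ut.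
have reB z w : cplx_re (z - w) = cplx_re z - cplx_re (w : XC).
  have := cplx_decomp (z - w).
  rewrite {1}(cplx_decomp z) {1}(cplx_decomp w) opprD addrACA -scalerBr -!cplx_inN -!cplx_inD.
  by move=> /(@cplx_eq _ _ XC)[].
have TE : T t x = cplx_re (rho%:C *: u t).
  rewrite /u scalerA -rmorphM divff ?gt_eqF// rmorph1 scale1r.
  by have := cplx_reK XC (T t x) 0; rewrite cplx_in0 scaler0 addr0.
rewrite TE -reB -scalerBr -ltcR.
apply: le_lt_trans (cplx_re_contractive _) _.
rewrite normrZ normc_def/= expr0n addr0 sqrtr_sqr (gtr0_norm rho0).
have -> : e%:C = rho%:C * (e / rho)%:C.
  by rewrite -rmorphM mulrC divfK// gt_eqF.
by rewrite ltr_pM2l// ltcR.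
Unshelve. all: by end_near. Qed.

End generator_domain.

Section strong_convergence.
Context (R : realType) (p : R) (p1 : 1 <= p).
Local Notation X := (lp p1).
Context (T : R -> {linear X -> X}).
Hypotheses (p2 : p <> 2) (hT : C0_semigroup T).
Hypothesis hw : weakly_asymptotically_contractive T.

Lemma ultra_cvg_converges_strongly :
  (forall H : set_system R, UltraFilter H -> +oo_R `<=` H ->
    forall x, cvg (T t x @[t --> H])) ->
  converges_strongly T.
Proof.
move=> ucv; have [Tc T0 TD Tcv] := hT.
have [M M0 MP] := semigroup_global_bound hT hw.
have [F [FU Foo]] := @ultraFilterLemma R (+oo_R) _.
have FP : ProperFilter F by exact: ultra_proper.
have shift_oo (s : R) : t + s @[t --> F] --> +oo_R.
  move=> P [B [_ BP]]; apply: Foo; exists (B - s); split; first exact: num_real.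
  by move=> t; rewrite ltrBlDr => /BP.
have Fge (B : R) : F [set t | B <= t] by apply: Foo; apply: nbhs_pinfty_ge; exact: num_real.
(* Meaningful for negative [s] too, as [t + s] is eventually nonnegative along [F]. *)
pose v x s := lim (T (t + s) x @[t --> F]).
have vP x s : T (t + s) x @[t --> F] --> v x s.
  have := ucv ((fun t => t + s) @ F) (ultra_fmap _ FU) (@shift_oo s) x.
  exact.
have v_eq x s y : T (t + s) x @[t --> F] --> y -> v x s = y by exact: cvg_lim.
have v_linear a x y s : v (a *: x + y) s = a *: v x s + v y s.
  apply: v_eq; under eq_fun do rewrite linearP.
  by apply: cvgD; [apply: cvgZl_tmp|]; exact: vP.
have vB x y s : v (x - y) s = v x s - v y s.
  have -> : x - y = -1 *: y + x by rewrite scaleN1r addrC.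
  by rewrite v_linear scaleN1r addrC.
have v_le x s : `|v x s| <= `|x|.
  exact: (orbit_limit_contraction hw (@shift_oo s) (vP x s)).
have v_orbit x : complete_orbit T (v x).
  move=> r s r0; apply/esym/v_eq.
  have : T r (T (t + s) x) @[t --> F] --> T r (v x s).
    by apply: (@cvg_comp _ _ _ _ (T r) _ _ _ (vP x s)); exact: Tc.
  apply: cvg_trans; apply: near_eq_cvg; near=> t.
  have ts : 0 <= t + s by rewrite -lerBlDr; near: t; exact: Fge.
  by rewrite /= -TD// addrC addrA.
have v_semigroup x r s : 0 <= r -> v (T r x) s = v x (s + r).
  move=> r0; apply: v_eq; have := vP x (s + r).
  apply: cvg_trans; apply: near_eq_cvg; near=> t.
  have ts : 0 <= t + s by rewrite -lerBlDr; near: t; exact: Fge.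
  by rewrite /= -TD// addrA.
(* [v x s] is also the value at [s - r] of the limit orbit that starts from [T r x]. *)
have v_le_T x s r : 0 <= r -> `|v x s| <= `|T r x|.
  by move=> r0; rewrite -(subrK r s) -v_semigroup// v_le.
have v_incr x s h : 0 <= h -> v x (s + h) - v x s = v (T h x - x) s.
  by move=> h0; rewrite vB v_semigroup.
have v_cont x : {for 0, continuous (v x)}.
  have incr h : `|v x 0 - v x h| <= `|T `|h| x - x|.
    have [h0|/ltW h0] := leP 0 h.
      by rewrite distrC ger0_norm//; have := v_incr x 0 h h0; rewrite add0r => ->.
    have := v_incr x h (- h); rewrite subrr oppr_ge0 => -> //.
    by rewrite ler0_norm.
  apply/cvgrPdist_le => e e0.
  move/cvgrPdist_le : (Tcv x) => /(_ e e0); rewrite near_withinE.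
  move=> /nbhs_ballP[d /= d0 hd]; apply/nbhs_ballP; exists d => // h.
  rewrite /ball_ /= sub0r normrN => hh.
  apply: le_trans (incr h) _.
  have [->|h0] := eqVneq h 0; first by rewrite normr0 T0 subrr normr0 ltW.
  rewrite distrC; apply: hd; last by rewrite /= normr_gt0.
  by rewrite -ball_normE/= sub0r normrN normr_id.
have v_cst x s : v x s = v x 0.
  (* [tau = t2 - t1] for two times, at least [n] apart, at which the orbit is within
     [1 / (2 (n + 1))] of [v x 0]. By [v_le_T] with [r = t1], the displacement of [v x] by [tau] is
     at most [|T t2 x - T t1 x|], uniformly in [s]. *)
  have /choice[tau tauP] : forall n : nat, exists tau : R, n%:R <= tau /\
      forall s, `|v x (s + tau) - v x s| <= n.+1%:R^-1.
    move=> n; have := vP x 0; have e0 : 0 < n.+1%:R^-1 / 2 :> R by rewrite divr_gt0 ?invr_gt0.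
    move=> /cvgrPdist_lt/(_ _ e0) near0.
    have [t1 [t10 /= ht1]] := filter_ex (filterI (Fge 0) near0).
    have [t2 [t20 /= ht2]] := filter_ex (filterI (Fge (t1 + n%:R)) near0).
    have t12 : n%:R <= t2 - t1 by rewrite lerBrDl.
    exists (t2 - t1); split => // s'.
    have t0 : 0 <= t2 - t1 by exact: le_trans t12.
    rewrite v_incr//; apply: le_trans (v_le_T _ _ _ t10) _.
    rewrite linearB/= -TD// subrKC.
    have -> : T t2 x - T t1 x = (v x 0 - T t1 x) - (v x 0 - T t2 x).
      by apply: lp_seqP => k; rewrite !(lp_seqD, lp_seqN); ring.
    apply: le_trans (ler_normB _ _) _; rewrite [leRHS]splitr.
    by rewrite !addr0 in ht1 ht2; rewrite lerD// ltW.
  have tauoo : tau n @[n --> \oo] --> +oo_R.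
    apply/cvgryPge => B; near=> n; have [nt _] := tauP n.
    by apply: le_trans nt; near: n; exact: nbhs_infty_ger.
  have rec : recurrent tau (v x).
    move=> s'; apply/cvgrPdist_lt => e e0; near=> n.
    have [_ h] := tauP n; rewrite distrC; apply: le_lt_trans (h s') _.
    by near: n; exact: near_infty_natSinv_lt (PosNum e0).
  exact: (complete_orbit_cst hT hw tauoo p2 (v_orbit x) rec (@v_cont x)).
pose Q x := v x 0.
have Qlin : linear Q by move=> a x y; exact: v_linear.
pose Qf : {linear X -> X} := HB.pack Q (GRing.isLinear.Build _ _ _ _ Q Qlin).
exists Qf; split.
  apply: (@lipschitz_linear_continuous _ _ _ Q 1) => [x y|x]; first exact: vB.
  by rewrite mul1r v_le.
move=> x.
have TQ t : 0 <= t -> T t (Q x) = Q x by move=> t0; rewrite v_orbit// v_cst.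
have QQ : Q (Q x) = Q x.
  apply: v_eq; apply: cvg_near_cst; near=> t.
  by rewrite addr0 TQ//; near: t; exact: Fge.
(* The orbit of [x - Q x] tends to 0 along [F], so it is small at some time [t0]; the uniform bound
   [M] keeps it small ever after. *)
have z0 : v (x - Q x) 0 = 0 by rewrite vB -/(Q _) -/(Q _) QQ subrr.
apply/cvgrPdist_lt => e e0.
have d0 : 0 < e / (M + 1) by rewrite divr_gt0// ltr_wpDl.
have := vP (x - Q x) 0; rewrite z0 => /cvgrPdist_lt/(_ _ d0) near0.
have [t0 [t00 /= ht0]] := filter_ex (filterI (Fge 0) near0).
rewrite sub0r normrN addr0 in ht0.
exists t0; split; first exact: num_real.
move=> t /ltW tt0 /=.
have tp : 0 <= t by exact: le_trans tt0.
have -> : Q x - T t x = - T t (x - Q x) by rewrite linearB/= TQ// opprB.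
rewrite normrN -(subrK t0 t) TD ?subr_ge0//.
apply: le_lt_trans (MP _ _ _) _; first by rewrite subr_ge0.
apply: le_lt_trans (_ : (M + 1) * `|T t0 (x - Q x)| < _).
  by rewrite ler_wpM2r// lerDl.
by rewrite mulrC -ltr_pdivlMr// ltr_wpDl.
Unshelve. all: by end_near. Qed.

End strong_convergence.

Theorem corollary2p8 (R : realType) (p : R) (p1 : 1 <= p) (p2 : p <> 2)
    (T : R -> {linear lp p1 -> lp p1}) (hT : C0_semigroup T)
    (XC : complexification (lp p1))
    (hw : weakly_asymptotically_contractive T) :
  point_spectrum XC (generator T) `&` imaginary_axis R `<=` [set 0] /\
  (compact_resolvent XC (generator T) -> converges_strongly T).
Proof.
split; first exact: point_spectrum_imaginary_axis.
move=> hc; have [M M0 MP] := semigroup_global_bound hT hw.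
apply: ultra_cvg_converges_strongly => // H HU Hoo.
exact: (resolvent_orbit_ultra_cvg hT M0 MP HU Hoo hc).
Qed.
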